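(* Let $G$ be an SE-graph, $\phi$ an $(I|J)$-flow and $\phi'$ an $(I'|J')$-flow in $G$. Let $\pi=\{f,g\}\in M(\phi,\phi')$ and let $(\psi,\psi')$ be the double flow obtained from $(\phi,\phi')$ by the flow exchange operation using the single couple $\pi$. Then: (i) if $\pi$ is an R-couple with $f<g$, then $w(\phi)w(\phi')=q\,w(\psi)w(\psi')$ when $f\in I$, and $w(\phi)w(\phi')=q^{-1}w(\psi)w(\psi')$ when $f\in I'$; if $\pi$ is a C-couple with $f<g$, then $w(\phi)w(\phi')=q\,w(\psi)w(\psi')$ when $f\in J$, and $w(\phi)w(\phi')=q^{-1}w(\psi)w(\psi')$ when $f\in J'$; (ii) if $\pi$ is an RC-couple, then $w(\phi)w(\phi')=w(\psi)w(\psi')$.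
   Context: Notation: $[p]=\{1,\dots,p\}$; $\mathcal E^{m,n}$ is the set of pairs $(I|J)$, $I\subseteq[m]$, $J\subseteq[n]$, $|I|=|J|$. Fix a field $\mathbb K$, $q\in\mathbb K^\ast$. An SE-graph is a finite directed graph $G=(V,E)$ embedded in the plane (planar with a fixed layout) such that: every edge is either horizontal (H-edge) directed to the right or vertical (V-edge) directed downward; there are distinguished sources $r_1,\dots,r_m$ on a vertical line in this order upward and sinks $c_1,\dots,c_n$ on a horizontal line in this order from left to right; sources are incident only with H-edges, sinks only with V-edges; every vertex lies on a directed path from a source to a sink. $W$ = set of inner vertices. $\mathcal L_G$ is the $\mathbb K$-algebra of Laurent polynomials in $W$ with relations, for distinct $u,v\in W$: $uv=qvu$ if there is a directed horizontal path from $u$ to $v$; $vu=quv$ if there is a directed vertical path from $u$ to $v$; $uv=vu$ otherwise. Edge weights: $w(e)=v$ if $e=(u,v)$ with $u$ a source; $w(e)=u^{-1}v$ for an H-edge $e=(u,v)$ with $u,v\in W$; $w(e)=1$ for V-edges; path weight = ordered product of edge weights. For $(I|J)\in\mathcal E^{m,n}$, an $(I|J)$-flow is a set of pairwise vertex-disjoint directed paths from $\{r_i:i\in I\}$ to $\{c_j:j\in J\}$; ordering its paths $P_1,\dots,P_k$ by increasing index of their source, its weight is $w(P_1)\cdots w(P_k)$ (ordered product). Let $Y^r=I\triangle I'$, $Y^c=J\triangle J'$. For an $(I|J)$-flow $\phi$ and an $(I'|J')$-flow $\phi'$ with edge sets $E_\phi,E_{\phi'}$, let $U=E_\phi\triangle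 E_{\phi'}$. In the subgraph formed by $U$ each vertex has degree 1, 2 or 4, the degree-1 vertices being $\{r_i:i\in Y^r\}\cup\{c_j:j\in Y^c\}$. Splitting each degree-4 vertex $v$ into nearby $v',v''$ (edges of $U$ entering $v$ enter $v'$, those leaving $v$ leave $v''$) yields a disjoint union of simple paths $P'_1,\dots,P'_k$ and cycles; the endpoints of $P'_i$ determine a pair $\pi_i$ of elements of $Y^r\sqcup Y^c$, $M(\phi,\phi')=\{\pi_1,\dots,\pi_k\}$, and $P(\pi_i)$ is the image of $P'_i$ in $G$. A couple is an R-couple if contained in $Y^r$, a C-couple if contained in $Y^c$, and an RC-couple otherwise. The flow exchange operation using $\pi\in M(\phi,\phi')$ produces $\psi$ with edge set $E_\phi\triangle E_{P(\pi)}$ and $\psi'$ with edge set $E_{\phi'}\triangle E_{P(\pi)}$; $\psi$ is an $(I\triangle(\pi\cap Y^r)\,|\,J\triangle(\pi\cap Y^c))$-flow and $\psi'$ an $(I'\triangle(\pi\cap Y^r)\,|\,J'\triangle(\pi\cap Y^c))$-flow. *)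

(* Defs.v *)
From HB Require Import structures.
From mathcomp Require Import all_boot all_order all_algebra.
Set Implicit Arguments. Unset Strict Implicit. Unset Printing Implicit Defensive.
Import Order.TTheory GRing.Theory Num.Theory.
Local Open Scope ring_scope.

(* Raw data of a planar layout of a finite digraph with sources/sinks.
   Vertex v sits at the point (px v, py v) of R x R; sources are
   src 0 .. src (nsrc-1) (= r_1..r_m), sinks snk 0 .. snk (nsnk-1) (= c_1..c_n). *)
Record graph_data (R : realFieldType) := GraphData {
  vert : finType;
  edge : rel vert;
  px : vert -> R;
  py : vert -> R;
  nsrc : nat;
  nsnk : nat;
  src : 'I_nsrc -> vert;
  snk : 'I_nsnk -> vert }.
Arguments vert {R} g.
Arguments edge {R} g.
Arguments px {R} g.
Arguments py {R} g.
Arguments nsrc {R} g.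
Arguments nsnk {R} g.
Arguments src {R} g.
Arguments snk {R} g.

Section SEgraph.
Variables (R : realFieldType) (G : graph_data R).
Local Notation V := (vert G).
Local Notation m := (nsrc G).
Local Notation n := (nsnk G).

Definition is_Hseg (u v : V) := (py G u == py G v) && (px G u < px G v).
Definition is_Vseg (u v : V) := (px G u == px G v) && (py G v < py G u).

Definition pos (v : V) : R * R := (px G v, py G v).

(* the point p lies on the (axis-parallel) straight segment [pos u, pos v] *)
Definition on_seg (p : R * R) (u v : V) :=
  [&& Num.min (px G u) (px G v) <= p.1, p.1 <= Num.max (px G u) (px G v),
      Num.min (py G u) (py G v) <= p.2 & p.2 <= Num.max (py G u) (py G v)].

Definition is_src (v : V) := [exists i, src G i == v].
Definition is_snk (v : V) := [exists j, snk G j == v].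
Definition inner (v : V) := ~~ is_src v && ~~ is_snk v.

Definition SEgraph : Prop :=
  (forall u v, edge G u v -> is_Hseg u v || is_Vseg u v) /\
  injective pos /\
  (forall u v w, edge G u v -> on_seg (pos w) u v -> w = u \/ w = v) /\
  (forall u1 v1 u2 v2 (p : R * R), edge G u1 v1 -> edge G u2 v2 ->
     (u1, v1) <> (u2, v2) -> on_seg p u1 v1 -> on_seg p u2 v2 ->
     exists w, [/\ p = pos w, w = u1 \/ w = v1 & w = u2 \/ w = v2]) /\
  (forall i j, px G (src G i) = px G (src G j)) /\
  (forall i j : 'I_m, (i < j)%N -> py G (src G i) < py G (src G j)) /\
  (forall i j, py G (snk G i) = py G (snk G j)) /\
  (forall i j : 'I_n, (i < j)%N -> px G (snk G i) < px G (snk G j)) /\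
  (forall i j, src G i != snk G j) /\
  (forall i v, (edge G (src G i) v -> is_Hseg (src G i) v) /\
               (edge G v (src G i) -> is_Hseg v (src G i))) /\
  (forall j v, (edge G (snk G j) v -> is_Vseg (snk G j) v) /\
               (edge G v (snk G j) -> is_Vseg v (snk G j))) /\
  (forall v, exists i j, connect (edge G) (src G i) v /\ connect (edge G) v (snk G j)).

Definition Hedge : rel V := fun u v => edge G u v && (py G u == py G v).
Definition Vedge : rel V := fun u v => edge G u v && (px G u == px G v).

(* A K-algebra A with elements x v and inverses xi v (v in W) satisfying the
   defining relations of L_G.  Since L_G is presented by exactly these
   generators and relations, an identity among words holds in L_G iff it holds
   in every such (A, x, xi). *)
Definition LG_rep (K : fieldType) (q : K) (A : algType K) (x xi : V -> A) : Prop :=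
  (forall v, inner v -> x v * xi v = 1 /\ xi v * x v = 1) /\
  (forall u v, inner u -> inner v -> u != v ->
     [/\ connect Hedge u v -> x u * x v = q *: (x v * x u),
         connect Vedge u v -> x v * x u = q *: (x u * x v) &
         ~~ connect Hedge u v -> ~~ connect Hedge v u ->
         ~~ connect Vedge u v -> ~~ connect Vedge v u ->
         x u * x v = x v * x u]).

Section Weights.
Variables (K : fieldType) (A : algType K) (x xi : V -> A).

Definition ew (u v : V) : A :=
  if is_src u then x v else if py G u == py G v then xi u * x v else 1.

Fixpoint pw (s : V) (p : seq V) : A :=
  if p is v :: p' then ew s v * pw v p' else 1.

Definition fw (I : {set 'I_m}) (P : 'I_m -> seq V) : A :=
  \prod_(i < m | i \in I) pw (src G i) (P i).
End Weights.

Definition is_flow (I : {set 'I_m}) (J : {set 'I_n}) (P : 'I_m -> seq V) : Prop :=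
  [/\ #|I| = #|J|,
      forall i, i \in I -> path (edge G) (src G i) (P i),
      [set last (src G i) (P i) | i in I] = [set snk G j | j in J] &
      forall i i', i \in I -> i' \in I -> i != i' ->
        forall v, v \in src G i :: P i -> v \notin src G i' :: P i'].

Definition pedges (s : V) (p : seq V) : seq (V * V) := zip (s :: p) p.
Definition flow_edges (I : {set 'I_m}) (P : 'I_m -> seq V) : {set V * V} :=
  [set e | [exists i, (i \in I) && (e \in pedges (src G i) (P i))]].

Definition symd (X : finType) (A B : {set X}) : {set X} := (A :\: B) :|: (B :\: A).

Definition incident (e : V * V) (v : V) := (e.1 == v) || (e.2 == v).
Definition degU (U : {set V * V}) (v : V) := #|[set e in U | incident e v]|.

(* Two edges of U are consecutive in the split graph: they share a vertex v,
   and if deg_U v = 4 (v is split into v', v'') both enter v or both leave v. *)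
Definition adjU (U : {set V * V}) : rel (V * V) := fun e f =>
  [&& e \in U, f \in U, e != f &
      [exists v, [&& incident e v, incident f v &
         (degU U v != 4) ||
         ((e.2 == v) && (f.2 == v)) || ((e.1 == v) && (f.1 == v))]]].

Definition terminals (I I' : {set 'I_m}) (J J' : {set 'I_n}) : {set 'I_m + 'I_n} :=
  [set t | match t with inl i => i \in symd I I' | inr j => j \in symd J J' end].
Definition tv (t : 'I_m + 'I_n) : V := match t with inl i => src G i | inr j => snk G j end.

Definition couple_r (a b : 'I_m + 'I_n) : {set 'I_m} := [set i | (inl i == a) || (inl i == b)].
Definition couple_c (a b : 'I_m + 'I_n) : {set 'I_n} := [set j | (inr j == a) || (inr j == b)].

End SEgraph.

(* Main.v *)
Require Import Defs.
From HB Require Import structures.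
From mathcomp Require Import all_boot all_order all_algebra.
From mathcomp Require Import zify ring lra.
Import Order.TTheory GRing.Theory Num.Theory.
Set Implicit Arguments. Unset Strict Implicit. Unset Printing Implicit Defensive.
Local Open Scope ring_scope.

(** Every edge weight is a monomial, and two such monomials commute up to a power of [q] that
    is bilinear in the edges.  Between two source-to-sink paths this exponent becomes local:
    it is the sum over pairs of consecutive horizontal edges minus the sum over pairs of
    consecutive vertical edges ([beta] below).  Hence disjoint paths commute, the
    self-interaction of a path only depends on its edges, and [w(phi)w(phi')] differs from
    [w(psi)w(psi')] by [q^N] with [2N = B(phi,phi') - B(psi,psi')].  As [psi = phi - delta]
    and [psi' = phi' + delta], where [delta] is the exchanged path with edges of [phi]
    counted positively and edges of [phi'] negatively, [2N = B(delta, phi + phi')].  Locally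
    this vanishes except where the exchanged path reverses from one flow to the other, and
    there it records a half turn to the left or to the right.  So [N] is the rotation number
    of a planar arc without crossings whose end directions are known; a discrete version of
    Hopf's Umlaufsatz evaluates it from the position of the two end points. *)

(** * Words in letters that commute up to powers of [q] *)

Section QuasiCommutation.
Variables (K : fieldType) (q : K) (A : algType K).
Hypothesis q0 : q != 0.

(** Only twice [N] is computed: the natural invariant of a word, the sum of exponents over ordered
    pairs of letters, changes by twice the exponent at each transposition. As [q] may be a root of
    unity and the algebra is arbitrary, no exponent is read off from an identity between weights;
    all are tracked as integers. The obstacle to locality is that horizontal edge weights interact
    at long range through vertical connections; these terms cancel only in sums over entire
    source-to-sink paths. For the rotation number, directions are reduced to signs: a slightly
    tilted sweep line makes every edge, vertical ones included, strictly increasing, so a secant is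
    forward or backward and a half turn changes its sign by 2, which matches the 2 in [2N]. An arc
    between two sources leaves forward and arrives backward, between two sinks the converse, whence
    one net half turn; between a source and a sink both end directions agree and there is none. The
    flows may meet at vertices of degree 4; the splitting there keeps the arc from crossing
    itself. *)

Definition qcomm (n : int) (a b : A) := a * b = q ^ n *: (b * a).

Lemma qcomm1l a : qcomm 0 1 a.
Proof. by rewrite /qcomm expr0z scale1r mul1r mulr1. Qed.

Lemma qcomm_sym n a b : qcomm n a b -> qcomm (- n) b a.
Proof.
by rewrite /qcomm => ->; rewrite scalerA -expfzDr // addNr expr0z scale1r.
Qed.

Lemma qcommMr n m a b c : qcomm n a b -> qcomm m a c -> qcomm (n + m) a (b * c).
Proof.
rewrite /qcomm => h1 h2.
by rewrite mulrA h1 -scalerAl -(mulrA b a c) h2 -scalerAr scalerA mulrA expfzDr.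
Qed.

Lemma qcommMl n m a b c : qcomm n a c -> qcomm m b c -> qcomm (n + m) (a * b) c.
Proof.
move=> /qcomm_sym h1 /qcomm_sym h2; rewrite -[n + m]opprK opprD.
exact/qcomm_sym/qcommMr.
Qed.

Lemma qcommVr n a b bi : b * bi = 1 -> bi * b = 1 -> qcomm n a b -> qcomm (- n) a bi.
Proof.
move=> h1 h2 /qcomm_sym hab; rewrite /qcomm.
rewrite -[a * bi]mul1r -h2 mulrA -[bi * b * a]mulrA hab -scalerAr -scalerAl.
by rewrite -[bi * (a * b) * bi]mulrA -[a * b * bi]mulrA h1 mulr1.
Qed.

Lemma qcommVl n a ai b : a * ai = 1 -> ai * a = 1 -> qcomm n a b -> qcomm (- n) ai b.
Proof. by move=> h1 h2 /qcomm_sym/(qcommVr h1 h2) /qcomm_sym; rewrite opprK. Qed.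

Variables (T : eqType) (L : T -> T -> int) (W : T -> A).

Fixpoint ordsum (s : seq T) : int :=
  if s is e :: s' then \sum_(f <- s') L e f + ordsum s' else 0.

Lemma ordsum_cat s1 s2 :
  ordsum (s1 ++ s2) = ordsum s1 + ordsum s2 + \sum_(e <- s1) \sum_(f <- s2) L e f.
Proof.
elim: s1 => [|e s1 IH] /=; first by rewrite big_nil add0r addr0.
by rewrite IH big_cat big_cons /=; ring.
Qed.

Lemma qcomm_prod e (s : seq T) : {in s, forall f, qcomm (L e f) (W e) (W f)} ->
  qcomm (\sum_(f <- s) L e f) (W e) (\prod_(f <- s) W f).
Proof.
elim: s => [|f s IH] h.
  by rewrite !big_nil /qcomm expr0z scale1r mul1r mulr1.
rewrite !big_cons; apply: qcommMr; first by apply: h; rewrite inE eqxx.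
by apply: IH => g gs; apply: h; rewrite inE gs orbT.
Qed.

Hypothesis Lanti : forall e f, L f e = - L e f.

(** Transposing neighbours [e], [f] costs [q ^ L e f] and changes the ordered pair sum by twice
    [L e f], so the exponent is governed by the two words and not by the route between them. The
    relations are asked for letters of [s1] only, because edge weights are known to satisfy them
    only on edges of the graph. *)
Lemma perm_prod_qcomm (s1 s2 : seq T) :
  {in s1 &, forall e f, qcomm (L e f) (W e) (W f)} -> perm_eq s1 s2 ->
  exists2 n : int, n *+ 2 = ordsum s1 - ordsum s2 &
    \prod_(e <- s1) W e = q ^ n *: \prod_(e <- s2) W e.
Proof.
elim: s1 s2 => [|e s1 IH] s2 hW.
  rewrite perm_sym => /perm_nilP ->.
  by exists 0; rewrite ?subrr ?mul0rn // expr0z scale1r.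
move=> peq.
have es2 : e \in s2 by rewrite -(perm_mem peq) inE eqxx.
case/splitPr: es2 peq => t u peq.
have peq' : perm_eq s1 (t ++ u).
  by rewrite -(perm_cons e) (perm_trans peq) // perm_catC /= perm_cons perm_catC.
have [n n2 eqn] : exists2 n : int, n *+ 2 = ordsum s1 - ordsum (t ++ u) &
    \prod_(e <- s1) W e = q ^ n *: \prod_(e <- t ++ u) W e.
  by apply: IH peq' => f g fs gs; apply: hW; rewrite inE ?fs ?gs orbT.
(* The head [e] of [s1] has to pass the block [t] that precedes it in [s2]. *)
exists (n + \sum_(f <- t) L e f).
  rewrite mulrnDl n2 /= !ordsum_cat /= (perm_big _ peq') /= big_cat /=.
  under [\sum_(e0 <- t) \sum_(f <- e :: u) _]eq_bigr => f _.
    rewrite big_cons Lanti; over.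
  rewrite big_split /= sumrN mulr2n; ring.
rewrite big_cons eqn !big_cat big_cons /= -scalerAr [W e * (_ * _)]mulrA.
have -> : W e * \prod_(f <- t) W f =
    q ^ (\sum_(f <- t) L e f) *: (\prod_(f <- t) W f * W e).
  apply: qcomm_prod => f ft; apply: hW; rewrite inE ?eqxx //.
  by rewrite (perm_mem peq') mem_cat ft orbT.
by rewrite -scalerAl scalerA -expfzDr // -mulrA.
Qed.

End QuasiCommutation.

(* Discrete Umlaufsatz: [sigma i j] is the sign of the secant from point [i] to point [j]
   and [s i j] the side on which edge [j] passes edge [i].  Summing the rotation of the
   secant around the elementary squares of the triangle [i < j] moves the total rotation
   of the tangent to the two legs of that triangle. *)
Lemma turning_sum (s sigma : nat -> nat -> int) (k : nat) :
  (forall i j, s j i = - s i j) -> (forall i j, sigma j i = - sigma i j) ->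
  (forall i j, (i.+1 < k)%N -> (j < k)%N -> j != i -> j != i.+1 ->
     sigma i.+1 j.+1 != sigma i.+1 j -> s i j = s i.+1 j) ->
  \sum_(0 <= i < k.-1) s i i.+1 * (sigma i.+1 i.+2 - sigma i i.+1) =
  \sum_(1 <= j < k) s 0%N j * (sigma 0%N j.+1 - sigma 0%N j)
  + \sum_(0 <= i < k.-1) s i k.-1 * (sigma i.+1 k - sigma i k).
Proof.
move=> sA gA; case: k => [|k]; first by rewrite !big_geq //= addr0.
elim: k => [|k IH] hC; first by rewrite /= !big_geq // addr0.
rewrite /= big_nat_recr //= IH /=; last first.
  move=> i j ik jk; apply: hC; first exact: ltnW.
  exact: ltnW.
rewrite [X in _ = X + _]big_nat_recr //= [X in _ = _ + X]big_nat_recr //=.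
(* The second leg moves from edge [k] to edge [k.+1]: where the sign seen from point [k.+1] jumps
   along edge [i], the hypothesis with the two roles exchanged equates the two sides. *)
have -> : \sum_(0 <= i < k) s i k * (sigma i.+1 k.+1 - sigma i k.+1)
        = \sum_(0 <= i < k) s i k.+1 * (sigma i.+1 k.+1 - sigma i k.+1).
  apply: eq_big_nat => i /andP[_ ik].
  have [->|ne] := eqVneq (sigma i.+1 k.+1) (sigma i k.+1); first by rewrite subrr !mulr0.
  rewrite sA [in RHS]sA; congr (- _ * _); apply: hC; try lia.
  by rewrite gA (gA i) eqr_opp.
pose g i := sigma i k.+2 - sigma i k.+1.
(* Where [g i.+1] is nonzero, edge [k.+1] changes sign as seen from point [i.+1], so its side
   relative to edge [i] is also its side relative to edge [i.+1], and the sum telescopes. *)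
have tele : \sum_(0 <= i < k) s i k.+1 * (g i.+1 - g i)
    = s k k.+1 * g k - s 0%N k.+1 * g 0%N.
  rewrite -(@telescope_sumr _ 0 k (fun i => s i k.+1 * g i)) //.
  apply: eq_big_nat => i /andP[_ ik].
  rewrite mulrBr; congr (_ - _); rewrite /g.
  have [->|ne] := eqVneq (sigma i.+1 k.+2) (sigma i.+1 k.+1); first by rewrite subrr !mulr0.
  by congr (_ * _); apply: hC => //; lia.
have -> : \sum_(0 <= i < k) s i k.+1 * (sigma i.+1 k.+2 - sigma i k.+2) =
  \sum_(0 <= i < k) s i k.+1 * (g i.+1 - g i)
  + \sum_(0 <= i < k) s i k.+1 * (sigma i.+1 k.+1 - sigma i k.+1).
  rewrite -big_split; apply: eq_bigr => i _ /=; rewrite /g; ring.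
rewrite tele /g; ring.
Qed.

(** * Reachability along an acyclic partial injection, as formed by the horizontal or the vertical
    edges *)

Section PartialInjection.
Variables (T : finType) (e : rel T).
Hypothesis efun : forall u v w, e u v -> e u w -> v = w.
Hypothesis einj : forall u v w, e u w -> e v w -> u = v.
Hypothesis eacyc : forall u v, e u v -> ~~ connect e v u.

Definition cdiff (a b : T) : int := (connect e a b)%:Z - (connect e b a)%:Z.

Lemma cdiff_anti a b : cdiff b a = - cdiff a b.
Proof. by rewrite /cdiff opprB. Qed.

Lemma connect_from u v w : e u v -> (connect e u w)%:Z = (w == u)%:Z + (connect e v w)%:Z.
Proof.
move=> euv; have [->|wu] := eqVneq w u.
  by rewrite connect0 (negPf (eacyc euv)).
rewrite add0r; congr (Posz (nat_of_bool _)); apply/idP/idP; last first.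
  exact: (connect_trans (connect1 euv)).
case/connectP => -[|z p] /=; first by move=> _ E; rewrite E eqxx in wu.
by case/andP => /(efun euv) <- pp ->; apply/connectP; exists p.
Qed.

Lemma connect_to u v w : e u v -> (connect e w v)%:Z = (w == v)%:Z + (connect e w u)%:Z.
Proof.
move=> euv; have [->|wv] := eqVneq w v.
  by rewrite connect0 (negPf (eacyc euv)).
rewrite add0r; congr (Posz (nat_of_bool _)); apply/idP/idP; last first.
  by move=> h; apply: connect_trans h (connect1 euv).
case/connectP => p; case/lastP: p => [|p z] /=; first by move=> _ E; rewrite E eqxx in wv.
rewrite rcons_path last_rcons => /andP[pp ez] vz; rewrite -vz in ez.
by rewrite (einj euv ez); apply/connectP; exists p.
Qed.

(** A vertex other than [u] and [v] is related to both in the same way. All locality of the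
    exponents comes from this. *)
Lemma cdiff_step u v w : e u v -> cdiff w v - cdiff w u = (w == u)%:Z + (w == v)%:Z.
Proof.
by move=> euv; rewrite /cdiff (connect_to w euv) (connect_from w euv); ring.
Qed.

Lemma eq_headtail u v u' v' : e u v -> e u' v' -> (u == u') = (v == v').
Proof.
move=> h h'; apply/eqP/eqP => [E|E].
  by rewrite -E in h'; apply: efun h h'.
by rewrite -E in h'; apply: einj h h'.
Qed.

Variable inn : pred T.

(** Sources and sinks are not generators; they are treated as the unit, which commutes with
    everything. *)
Definition mdiff (a b : T) : int := if inn a && inn b then cdiff a b else 0.

Lemma mdiff_anti a b : mdiff b a = - mdiff a b.
Proof. by rewrite /mdiff andbC; case: ifP => // _; rewrite ?oppr0 // cdiff_anti. Qed.

(** If [g] gives the exponents between generators, this mixed second difference is the exponent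
    between the monomials (tail inverse times head) of two edges. *)
Definition bdiff (g : T -> T -> int) (x y : T * T) : int :=
  g x.2 y.2 - g x.1 y.2 - (g x.2 y.1 - g x.1 y.1).

Lemma bdiff_anti g : (forall a b, g b a = - g a b) ->
  forall x y, bdiff g y x = - bdiff g x y.
Proof. by move=> h x y; rewrite /bdiff !(h x.1) !(h x.2); ring. Qed.

Lemma bdiff_cdiff u v u' v' : e u v -> e u' v' ->
  bdiff cdiff (u, v) (u', v') = (v == u')%:Z - (v' == u)%:Z.
Proof.
move=> h h'; rewrite /bdiff /=.
have E1 := cdiff_step v h'; have E2 := cdiff_step u h'.
have := eq_headtail h h'; rewrite (eq_sym v') => E.
by rewrite E in E2; lia.
Qed.

Lemma cdiff_init z w : (forall y, ~~ e y z) -> cdiff z w = (connect e z w && (z != w))%:Z.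
Proof.
move=> hz; rewrite /cdiff; have [<-|zw] := eqVneq z w; first by rewrite andbF subrr.
suff -> : connect e w z = false by rewrite andbT subr0.
apply/negP => /connectP[p]; case/lastP: p => [|p y] /=.
  by move=> _ E; rewrite E eqxx in zw.
rewrite rcons_path last_rcons => /andP[_ ey] E; rewrite -E in ey.
by have := hz (last w p); rewrite ey.
Qed.

(** Erasing an initial vertex [z] costs nothing: an edge not starting at [z] has both ends reachable
    from [z] or neither, so the dropped terms cancel in the difference. If both edges start at [z],
    the two extra indicators cancel each other. *)
Lemma bdiff_mdiff u v u' v' : e u v -> e u' v' -> inn v -> inn v' ->
  (inn u \/ forall y, ~~ e y u) -> (inn u' \/ forall y, ~~ e y u') ->
  bdiff mdiff (u, v) (u', v') = (v == u')%:Z - (v' == u)%:Z.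
Proof.
move=> h h' iv iv' hu hu'.
rewrite -(bdiff_cdiff h h') /bdiff /mdiff /= iv iv' /= andbT.
have key z a b : (forall y, ~~ e y z) -> e a b -> cdiff z b = (a == z)%:Z + cdiff z a.
  move=> hz hab; rewrite !cdiff_init //.
  have bz : z != b by apply/eqP => E; have := hz a; rewrite E hab.
  rewrite bz andbT (connect_to z hab) (negPf bz) add0r.
  by have [->|az] := eqVneq a z; rewrite ?eqxx ?connect0 ?andbT //= eq_sym az andbT add0r.
have A1 := cdiff_anti u' v; have A2 := cdiff_anti u' u.
case: (boolP (inn u)) hu => iu hu; case: (boolP (inn u')) hu' => iu' hu' //=.
- case: hu' => // /key /(_ h); have [E|_] := eqVneq u u'; first by move: iu'; rewrite -E iu.
  by rewrite add0r A1 A2 => ->; ring.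
- case: hu => // /key /(_ h'); have [E|_] := eqVneq u' u; first by move: iu; rewrite -E iu'.
  by rewrite add0r => ->; ring.
- case: hu => // hu; case: hu' => // hu'.
  move: A1 (key _ _ _ hu h') (key _ _ _ hu' h) => -> -> ->.
  have uu' : cdiff u u' = 0.
    apply: le_anti; apply/andP; split; last by rewrite cdiff_init.
    by rewrite A2 oppr_le0 cdiff_init.
  have u'u : cdiff u' u = 0 by rewrite cdiff_anti uu' oppr0.
  by rewrite uu' u'u (eq_sym u'); ring.
Qed.
End PartialInjection.

(** * Planar geometry of SE-graphs *)

Section Geometry.
Variables (R : realFieldType) (G : graph_data R).
Hypothesis SE : SEgraph G.
Local Notation V := (vert G).
Local Notation px := (px G).
Local Notation py := (py G).
Local Notation Hedge := (@Hedge R G).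
Local Notation Vedge := (@Vedge R G).
Local Notation inner := (@inner R G).
Local Notation is_src := (@is_src R G).
Local Notation is_snk := (@is_snk R G).
Local Notation tv := (@tv R G).

Lemma HedgeP u v : Hedge u v -> py u = py v /\ px u < px v.
Proof.
case: SE => h _ /andP[/h + /eqP e]; rewrite /is_Hseg /is_Vseg e ltxx andbF orbF.
by case/andP.
Qed.

Lemma VedgeP u v : Vedge u v -> px u = px v /\ py v < py u.
Proof.
case: SE => h _ /andP[/h + /eqP e]; rewrite /is_Hseg /is_Vseg e ltxx andbF /=.
by case/andP.
Qed.

Lemma edge_cases u v : edge G u v -> {Hedge u v} + {Vedge u v}.
Proof.
move=> uv; have [e|ne] := boolP (py u == py v); first by left; rewrite /Hedge uv.
right; case: SE => /(_ _ _ uv) + _; rewrite /is_Hseg (negPf ne) /=.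
by case/andP => e _; rewrite /Vedge uv.
Qed.

Lemma Hedge_edge : subrel Hedge (edge G). Proof. by move=> u v /andP[]. Qed.
Lemma Vedge_edge : subrel Vedge (edge G). Proof. by move=> u v /andP[]. Qed.

(* The order in which a vertical line tilted infinitesimally towards the antidiagonal
   sweeps the vertices from left to right. *)
Definition klt (u v : V) := (px u < px v) || ((px u == px v) && (py v < py u)).

Lemma kltP u v : reflect (px u < px v \/ px u = px v /\ py v < py u) (klt u v).
Proof.
apply: (iffP orP) => -[]; [by left| |by left|].
  by case/andP => /eqP ? ?; right.
by case=> /eqP ? ?; right; apply/andP.
Qed.

Lemma klt_trans : transitive klt.
Proof.
move=> b a c /kltP h1 /kltP h2; apply/kltP.
by case: h1 h2 => [h1|[h1 h1']] [h2|[h2 h2']]; [left|left|left|right; split]; lra.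
Qed.

Lemma klt_irr u : klt u u = false.
Proof. by rewrite /klt !ltxx andbF. Qed.

Lemma klt_asym u v : klt u v -> klt v u = false.
Proof. by move=> h; apply/negP => /(klt_trans h); rewrite klt_irr. Qed.

Lemma klt_neq u v : klt u v -> u != v.
Proof. by apply: contraTneq => ->; rewrite klt_irr. Qed.

Lemma klt_total u v : u != v -> klt u v || klt v u.
Proof.
move=> uv; case: SE => _ [pinj _]; rewrite /klt.
have [//|//|ex] /= := ltgtP (px u) (px v).
have [//|//|ey] /= := ltgtP (py u) (py v).
by move: uv; rewrite (pinj u v) ?eqxx // /pos ex ey.
Qed.

Lemma edge_klt u v : edge G u v -> klt u v.
Proof.
move=> /edge_cases[/HedgeP[_ h]|/VedgeP[h1 h2]]; apply/kltP; first by left.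
by right.
Qed.

Lemma path_klt s p v : path (edge G) s p -> v \in p -> klt s v.
Proof.
elim: p s => [|z p IH] s //= /andP[/edge_klt sz pp]; rewrite inE => /orP[/eqP->//|vp].
exact: klt_trans sz (IH _ pp vp).
Qed.

Lemma path_uniq s p : path (edge G) s p -> uniq (s :: p).
Proof.
elim: p s => [|z p IH] s //= /andP[sz pp]; move: (IH _ pp) => /= ->.
rewrite andbT; apply/negP => /(path_klt (s := s) (p := z :: p)).
by rewrite /= sz pp klt_irr => /(_ isT).
Qed.

Lemma connect_klt (r : rel V) u v : subrel r (edge G) -> connect r u v -> u = v \/ klt u v.
Proof.
move=> sub /connectP[p pp ->]; case: p pp => [|z p] pp; [by left|right].
by apply: path_klt (sub_path sub pp) _; rewrite /= mem_last.
Qed.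

Lemma connect_acyc (r : rel V) u v : subrel r (edge G) -> r u v -> ~~ connect r v u.
Proof.
move=> sub /[dup] uv /sub/edge_klt h; apply/negP => /(connect_klt sub)[E|h'].
  by rewrite E klt_irr in h.
by rewrite (klt_asym h) in h'.
Qed.

Lemma on_segH u v p : px u < px v -> py u = py v -> px u <= p.1 -> p.1 <= px v ->
  p.2 = py u -> on_seg p u v.
Proof.
move=> h e h1 h2 e2; rewrite /on_seg -e e2 minxx maxxx lexx andbT /=.
by rewrite (min_l (ltW h)) (max_r (ltW h)) h1 h2 ?lexx.
Qed.

Lemma on_segV u v p : px u = px v -> py v < py u -> p.1 = px u -> py v <= p.2 ->
  p.2 <= py u -> on_seg p u v.
Proof.
move=> e h e1 h1 h2; rewrite /on_seg -e e1 minxx maxxx lexx /=.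
by rewrite (min_r (ltW h)) (max_l (ltW h)) h1 h2.
Qed.

Lemma vertex_on_edge u v w : edge G u v -> on_seg (pos w) u v -> w = u \/ w = v.
Proof. by case: SE => _ [_ [h _]]; apply: h. Qed.

Lemma Hfun u v w : Hedge u v -> Hedge u w -> v = w.
Proof.
wlog le : v w / px v <= px w.
  by move=> th h1 h2; have [le|/ltW le] := leP (px v) (px w); [|symmetry]; apply: th.
move=> /HedgeP[e1 l1] /[dup] /Hedge_edge uw /HedgeP[e2 l2].
have [] : v = u \/ v = w; last by []; first apply: (vertex_on_edge uw).
  by apply: on_segH => //=; lra.
by move=> E; rewrite E ltxx in l1.
Qed.

Lemma Hinj u v w : Hedge u w -> Hedge v w -> u = v.
Proof.
wlog le : u v / px u <= px v.
  by move=> th h1 h2; have [le|/ltW le] := leP (px u) (px v); [|symmetry]; apply: th.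
move=> /[dup] /Hedge_edge uw /HedgeP[e1 l1] /HedgeP[e2 l2].
have [] : v = u \/ v = w; first apply: (vertex_on_edge uw).
- by apply: on_segH => //=; lra.
- by [].
by move=> E; rewrite E ltxx in l2.
Qed.

Lemma Vfun u v w : Vedge u v -> Vedge u w -> v = w.
Proof.
wlog le : v w / py w <= py v.
  by move=> th h1 h2; have [le|/ltW le] := leP (py w) (py v); [|symmetry]; apply: th.
move=> /VedgeP[e1 l1] /[dup] /Vedge_edge uw /VedgeP[e2 l2].
have [] : v = u \/ v = w; last by []; first apply: (vertex_on_edge uw).
  by apply: on_segV => //=; lra.
by move=> E; rewrite E ltxx in l1.
Qed.

Lemma Vinj u v w : Vedge u w -> Vedge v w -> u = v.
Proof.
wlog le : u v / py v <= py u.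
  by move=> th h1 h2; have [le|/ltW le] := leP (py v) (py u); [|symmetry]; apply: th.
move=> /[dup] /Vedge_edge uw /VedgeP[e1 l1] /VedgeP[e2 l2].
have [] : v = u \/ v = w; first apply: (vertex_on_edge uw).
- by apply: on_segV => //=; lra.
- by [].
by move=> E; rewrite E ltxx in l2.
Qed.

(** Such a [w] would share the abscissa of the edge and lie on it. Hence only horizontal edges can
    pass strictly over or under a vertex in the sweep. *)
Lemma Vedge_gap u v w : Vedge u v -> klt u w -> klt w v -> False.
Proof.
move=> /[dup] /Vedge_edge uv /VedgeP[e l] uw wv.
have [E|E] : w = u \/ w = v; last by rewrite E klt_irr in wv.
  move/kltP: uw => uw; move/kltP: wv => wv.
  by apply: (vertex_on_edge uv); apply: on_segV => //=; case: uw wv => [h|[h h']] [k|[k k']]; lra.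
by rewrite E klt_irr in uw.
Qed.

Lemma Hedge_off c d p : Hedge c d -> klt c p -> klt p d -> py p != py c.
Proof.
move=> /[dup] /Hedge_edge cd /HedgeP[e l] cp pd; apply/eqP => E.
have [E'|E'] : p = c \/ p = d; last by rewrite E' klt_irr in pd.
  move/kltP: cp => cp; move/kltP: pd => pd.
  by apply: (vertex_on_edge cd); apply: on_segH => //=; case: cp pd => [h|[h h']] [k|[k k']]; lra.
by rewrite E' klt_irr in cp.
Qed.

(** The edges would meet at abscissa [px u] and height [py c]; by planarity that point is an end of
    the vertical edge, against the strict inequalities on heights. *)
Lemma HV_no_cross c d u v : Hedge c d -> Vedge u v -> px c <= px u -> px u <= px d ->
  py v < py c -> py c < py u -> False.
Proof.
move=> Hcd Vuv; have [e1 l1] := HedgeP Hcd; have [e2 l2] := VedgeP Vuv => h1 h2 h3 h4.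
case: SE => _ [_ [_ [/(_ c d u v (px u, py c)) + _]]].
case/(_ (Hedge_edge Hcd) (Vedge_edge Vuv)).
- by case=> E _; rewrite E ltxx in h4.
- by apply: on_segH.
- by apply: on_segV => //=; apply: ltW.
move=> w [[_ ew] _ [E|E]]; rewrite E in ew.
  by rewrite ew ltxx in h4.
by rewrite ew ltxx in h3.
Qed.

Lemma path_px s p : path (edge G) s p -> px s <= px (last s p).
Proof.
elim: p s => [|z p IH] s //= /andP[sz /IH]; apply: le_trans.
by case/edge_cases: sz => [/HedgeP[_ /ltW]|/VedgeP[->]].
Qed.

Lemma path_py s p : path (edge G) s p -> py (last s p) <= py s.
Proof.
elim: p s => [|z p IH] s //= /andP[sz /IH] /le_trans; apply.
by case/edge_cases: sz => [/HedgeP[->]|/VedgeP[_ /ltW]].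
Qed.

(** Every vertex is reached from a source along edges that never decrease [px], and all sources
    share one abscissa. Being leftmost, sources receive no edge; dually, sinks are lowest and emit
    none. *)
Lemma src_px_le i v : px (src G i) <= px v.
Proof.
case: SE => _ [_ [_ [_ [ex [_ [_ [_ [_ [_ [_ /(_ v)]]]]]]]]]].
by case=> i' [j [/connectP[p pp ->] _]]; rewrite (ex i i'); apply: path_px.
Qed.

Lemma snk_py_le j v : py (snk G j) <= py v.
Proof.
case: SE => _ [_ [_ [_ [_ [_ [ey [_ [_ [_ [_ /(_ v)]]]]]]]]]].
by case=> i [j' [_ /connectP[p pp e]]]; rewrite (ey j j') e; apply: path_py.
Qed.

Lemma src_edge i v : edge G (src G i) v -> Hedge (src G i) v.
Proof.
move=> /[dup] iv; case: SE => _ [_ [_ [_ [_ [_ [_ [_ [_ [/(_ i v) [+ _] _]]]]]]]]].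
by move=> h /h /andP[e _]; rewrite /Hedge iv.
Qed.

Lemma snk_edge j v : edge G v (snk G j) -> Vedge v (snk G j).
Proof.
move=> /[dup] vj; case: SE => _ [_ [_ [_ [_ [_ [_ [_ [_ [_ [/(_ j v) [_ +] _]]]]]]]]]].
by move=> h /h /andP[e _]; rewrite /Vedge vj.
Qed.

Lemma no_in_src i v : edge G v (src G i) = false.
Proof.
apply/negP => vi; case: SE => _ [_ [_ [_ [_ [_ [_ [_ [_ [/(_ i v) [_ h] _]]]]]]]]].
by case/andP: (h vi) => _; rewrite ltNge src_px_le.
Qed.

Lemma no_out_snk j v : edge G (snk G j) v = false.
Proof.
apply/negP => jv; case: SE => _ [_ [_ [_ [_ [_ [_ [_ [_ [_ [/(_ j v) [h _] _]]]]]]]]]].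
by case/andP: (h jv) => _; rewrite ltNge snk_py_le.
Qed.

Lemma is_srcP v : reflect (exists i, v = src G i) (is_src v).
Proof. by apply: (iffP existsP) => -[i]; [move/eqP|move=> ->]; exists i. Qed.

Lemma is_snkP v : reflect (exists i, v = snk G i) (is_snk v).
Proof. by apply: (iffP existsP) => -[i]; [move/eqP|move=> ->]; exists i. Qed.

Lemma is_src_src i : is_src (src G i). Proof. by apply/is_srcP; exists i. Qed.
Lemma is_snk_snk j : is_snk (snk G j). Proof. by apply/is_snkP; exists j. Qed.

Lemma src_not_snk i : is_snk (src G i) = false.
Proof.
apply/idP => /is_snkP[j E]; case: SE => _ [_ [_ [_ [_ [_ [_ [_ [/(_ i j)]]]]]]]].
by rewrite E eqxx.
Qed.

Lemma snk_not_src j : is_src (snk G j) = false.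
Proof. by apply/idP => /is_srcP[i E]; have := src_not_snk i; rewrite -E is_snk_snk. Qed.

Lemma src_px_lt i v : ~~ is_src v -> px (src G i) < px v.
Proof.
case: SE => _ [_ [_ [_ [ex [_ [_ [_ [_ [_ [_ /(_ v)]]]]]]]]]].
case=> i' [j [/connectP[[|z p] pp ev] _]]; first by rewrite ev is_src_src.
move=> _; rewrite ev (ex i i'); case/andP: pp => /src_edge/HedgeP[_ /lt_le_trans h] pp.
by apply: h; apply: path_px.
Qed.

Lemma snk_py_lt j v : ~~ is_snk v -> py (snk G j) < py v.
Proof.
case: SE => _ [_ [_ [_ [_ [_ [ey [_ [_ [_ [_ /(_ v)]]]]]]]]]].
case=> i [j' [_ /connectP[p]]]; case/lastP: p => [|p z]; first by move=> _ /= <-; rewrite is_snk_snk.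
rewrite last_rcons rcons_path (ey j j') => /andP[pp ez] E _; rewrite -E in ez.
by case/snk_edge/VedgeP: ez => _ /lt_le_trans; apply; apply: path_py.
Qed.

Lemma src_inj : injective (src G).
Proof.
case: SE => _ [_ [_ [_ [_ [h _]]]]] i j E; apply/val_inj => /=.
have [/h|/h|//] := ltngtP (i : nat) j; by rewrite E ltxx.
Qed.

Lemma snk_inj : injective (snk G).
Proof.
case: SE => _ [_ [_ [_ [_ [_ [_ [h _]]]]]]] i j E; apply/val_inj => /=.
have [/h|/h|//] := ltngtP (i : nat) j; by rewrite E ltxx.
Qed.

Lemma tv_inj : injective tv.
Proof.
move=> [i|i] [j|j] /= E; first by rewrite (src_inj E).
- by have := src_not_snk i; rewrite E is_snk_snk.
- by have := src_not_snk j; rewrite -E is_snk_snk.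
by rewrite (snk_inj E).
Qed.

Lemma tv_not_inner t : inner (tv t) = false.
Proof. by case: t => i; rewrite /inner /= ?is_src_src // is_snk_snk andbF. Qed.

Lemma not_inner u : ~~ inner u -> is_src u \/ is_snk u.
Proof. by rewrite /inner negb_and !negbK => /orP. Qed.

Lemma head_not_src u v : edge G u v -> ~~ is_src v.
Proof. by move=> uv; apply/is_srcP => -[i E]; rewrite E no_in_src in uv. Qed.

Lemma tail_not_snk u v : edge G u v -> ~~ is_snk u.
Proof. by move=> uv; apply/is_snkP => -[i E]; rewrite E no_out_snk in uv. Qed.

Lemma Hhead_inner u v : Hedge u v -> inner v.
Proof.
move=> uv; rewrite /inner (head_not_src (Hedge_edge uv)) /=.
apply/is_snkP => -[j E]; rewrite E in uv.
case/HedgeP: (uv) => e _; case/VedgeP: (snk_edge (Hedge_edge uv)) => _.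
by rewrite e ltxx.
Qed.

Lemma Vtail_inner u v : Vedge u v -> inner u.
Proof.
move=> uv; rewrite /inner (tail_not_snk (Vedge_edge uv)) andbT.
apply/is_srcP => -[j E]; rewrite E in uv.
case/VedgeP: (uv) => e _; case/HedgeP: (src_edge (Vedge_edge uv)) => _.
by rewrite e ltxx.
Qed.

Lemma Hacyc u v : Hedge u v -> ~~ connect Hedge v u.
Proof. exact: connect_acyc Hedge_edge. Qed.

Lemma Vacyc u v : Vedge u v -> ~~ connect Vedge v u.
Proof. exact: connect_acyc Vedge_edge. Qed.

Lemma connectH_py u v : connect Hedge u v -> py u = py v.
Proof.
case/connectP => p + ->; elim: p u => [|z p IH] u //= /andP[/HedgeP[-> _] /IH].
by [].
Qed.

Lemma connectV_px u v : connect Vedge u v -> px u = px v.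
Proof.
case/connectP => p + ->; elim: p u => [|z p IH] u //= /andP[/VedgeP[-> _] /IH].
by [].
Qed.

End Geometry.

(** * Commutation exponents *)

Section Exponents.
Variables (R : realFieldType) (G : graph_data R).
Hypothesis SE : SEgraph G.
Local Notation V := (vert G).
Local Notation px := (px G).
Local Notation py := (py G).
Local Notation Hedge := (@Hedge R G).
Local Notation Vedge := (@Vedge R G).
Local Notation inner := (@inner R G).
Local Notation is_src := (@is_src R G).
Local Notation is_snk := (@is_snk R G).
Local Notation pedges := (@pedges R G).
Implicit Types (e f : V * V) (s t u v w : V) (p r : seq V).

Definition isH e := py e.1 == py e.2.
Definition lamH := mdiff Hedge inner.
Definition lamV := mdiff Vedge inner.
(** The vertical term is subtracted because a vertical path from [u] to [v] imposes [vu = q uv], the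
    reverse of the horizontal relation. *)
Definition lam u v := lamH u v - lamV u v.
Definition qexp e f : int := if isH e && isH f then bdiff lam e f else 0.
Definition adj e f : int := (e.2 == f.1)%:Z - (f.2 == e.1)%:Z.
Definition beta e f : int :=
  if isH e then (if isH f then adj e f else 0) else (if isH f then 0 else - adj e f).

Lemma adj_anti e f : adj f e = - adj e f.
Proof. by rewrite /adj opprB. Qed.

Lemma beta_anti e f : beta f e = - beta e f.
Proof. by rewrite /beta; case: (isH e); case: (isH f); rewrite ?oppr0 // adj_anti. Qed.

Lemma lam_anti u v : lam v u = - lam u v.
Proof. by rewrite /lam /lamH /lamV (mdiff_anti _ _ u v) (mdiff_anti Vedge _ u v); ring. Qed.

Lemma qexp_anti e f : qexp f e = - qexp e f.
Proof.
rewrite /qexp andbC; case: ifP => _; last by rewrite oppr0.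
exact: bdiff_anti lam_anti _ _.
Qed.

Lemma bdiff_lam e f : bdiff lam e f = bdiff lamH e f - bdiff lamV e f.
Proof. by rewrite /bdiff /lam; ring. Qed.

Lemma edge_isH e : edge G e.1 e.2 -> isH e -> Hedge e.1 e.2.
Proof. by move=> h1 h2; rewrite /Hedge h1. Qed.

Lemma edge_isV e : edge G e.1 e.2 -> ~~ isH e -> Vedge e.1 e.2.
Proof. by move=> /(edge_cases SE)[/andP[_]|//]; rewrite /isH => ->. Qed.

Lemma bdiff_lamH e f : Hedge e.1 e.2 -> Hedge f.1 f.2 -> bdiff lamH e f = adj e f.
Proof.
case: e f => u v [u' v'] /= h h'.
have hd w z : Hedge w z -> inner w \/ forall y, ~~ Hedge y w.
  move=> hw; have [|/not_inner[]] := boolP (inner w); first by left.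
    case/is_srcP => i ->; right=> y; apply/negP => /Hedge_edge.
    by rewrite no_in_src.
  case/is_snkP => j E; move: hw => /Hedge_edge; by rewrite E no_out_snk.
exact: (bdiff_mdiff (Hfun SE) (Hinj SE) (Hacyc SE) h h'
  (Hhead_inner SE h) (Hhead_inner SE h') (hd _ _ h) (hd _ _ h')).
Qed.

Lemma bdiff_lamV e f : Vedge e.1 e.2 -> Vedge f.1 f.2 -> bdiff lamV e f = adj e f.
Proof.
case: e f => u v [u' v'] /= h h'.
(* On a vertical edge it is the head that may fail to be inner, whereas [bdiff_mdiff] tolerates
   exceptional tails only; hence the reversed relation. *)
pose rV := fun a b => Vedge b a.
have E a b : mdiff rV inner a b = - lamV a b.
  rewrite /lamV -mdiff_anti /mdiff andbC; case: ifP => // _.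
  by rewrite /cdiff !(connect_rev Vedge).
have hd w z : Vedge z w -> inner w \/ forall y, ~~ rV y w.
  move=> hw; have [|/not_inner[]] := boolP (inner w); first by left.
    case/is_srcP => j E'; move: hw => /Vedge_edge; by rewrite E' no_in_src.
  case/is_snkP => i ->; right=> y; apply/negP => /Vedge_edge.
  by rewrite no_out_snk.
have ac a b : rV a b -> ~~ connect rV b a.
  by move=> /(Vacyc SE); rewrite (connect_rev Vedge).
have := bdiff_mdiff (fun a b c h1 h2 => Vinj SE h1 h2) (fun a b c h1 h2 => Vfun SE h1 h2) ac
  h h' (Vtail_inner SE h) (Vtail_inner SE h') (hd _ _ h) (hd _ _ h').
rewrite /bdiff /= !E /adj /= (eq_sym v) (eq_sym v').
set c1 := (u' == v)%:Z; set c2 := (u == v')%:Z => H.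
by rewrite -[RHS]opprB -H; ring.
Qed.

Section Representation.
Variables (K : fieldType) (q : K) (A : algType K) (x xi : V -> A).
Hypotheses (q0 : q != 0) (rep : LG_rep q x xi).

(** Between distinct vertices at most one of the four directed connections exists: opposite ones
    contradict the order [klt], and a horizontal one together with a vertical one would place both
    vertices at the same point. So [lam] selects exactly the relation that applies. *)
Lemma qcomm_x u v : inner u -> inner v -> qcomm q (lam u v) (x u) (x v).
Proof.
move=> iu iv; rewrite /lam /lamH /lamV /mdiff iu iv /= /cdiff.
have [<-|uv] := eqVneq u v; first by rewrite !subrr /qcomm expr0z scale1r.
case: rep => _ rel; have [h1 h2 h3] := rel _ _ iu iv uv.
have vu : v != u by rewrite eq_sym.
have [k1 k2 _] := rel _ _ iv iu vu.
have xH a b : connect Hedge a b -> a != b ->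
    [&& ~~ connect Hedge b a, ~~ connect Vedge a b & ~~ connect Vedge b a].
  move=> ab ne; apply/and3P; split; apply/negP => h.
  - have [E|l] := connect_klt SE (@Hedge_edge _ G) ab; first by rewrite E eqxx in ne.
    have [E|l'] := connect_klt SE (@Hedge_edge _ G) h; first by rewrite E eqxx in ne.
    by rewrite (klt_asym l) in l'.
  - case: SE => _ [pinj _]; move/eqP: ne; apply; apply: pinj.
    by rewrite /pos (connectH_py SE ab) (connectV_px SE h).
  - case: SE => _ [pinj _]; move/eqP: ne; apply; apply: pinj.
    by rewrite /pos (connectH_py SE ab) (connectV_px SE h).
have xV a b : connect Vedge a b -> a != b -> ~~ connect Vedge b a.
  move=> ab ne; apply/negP => h.
  have [E|l] := connect_klt SE (@Vedge_edge _ G) ab; first by rewrite E eqxx in ne.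
  have [E|l'] := connect_klt SE (@Vedge_edge _ G) h; first by rewrite E eqxx in ne.
  by rewrite (klt_asym l) in l'.
have [c|c] := boolP (connect Hedge u v).
  have /and3P[/negPf-> /negPf-> /negPf->] := xH _ _ c uv.
  by rewrite /qcomm h1.
have [c'|c'] := boolP (connect Hedge v u).
  have /and3P[_ /negPf-> /negPf->] := xH _ _ c' vu.
  by apply: (qcomm_sym (n := 1) q0); rewrite /qcomm k1.
have [d|d] := boolP (connect Vedge u v).
  rewrite (negPf (xV _ _ d uv)); apply: (qcomm_sym (n := 1) q0).
  by rewrite /qcomm h2.
have [d'|d'] := boolP (connect Vedge v u); first by rewrite /qcomm k2.
by rewrite /qcomm expr0z scale1r; apply: h3.
Qed.

(** With the unit in place of the missing inverse of a source, both kinds of horizontal edge weights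
    take one form. *)
Let yi u : A := if inner u then xi u else 1.

Lemma ew_H e : Hedge e.1 e.2 -> ew x xi e.1 e.2 = yi e.1 * x e.2.
Proof.
move=> h; rewrite /ew /yi /Defs.inner (tail_not_snk SE (Hedge_edge h)) andbT.
by case: ifP => //= _; rewrite ?mul1r //; case/andP: h => _ ->.
Qed.

Lemma ew_V e : Vedge e.1 e.2 -> ew x xi e.1 e.2 = 1.
Proof.
move=> h; rewrite /ew; have := Vtail_inner SE h; rewrite /Defs.inner => /andP[/negPf-> _].
by have [_ l] := VedgeP SE h; rewrite gt_eqF.
Qed.

Lemma lam_out u v : ~~ (inner u && inner v) -> lam u v = 0.
Proof. by move=> h; rewrite /lam /lamH /lamV /mdiff (negPf h) subrr. Qed.

Lemma qcomm_yx u v : inner v -> qcomm q (- lam u v) (yi u) (x v).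
Proof.
move=> iv; rewrite /yi; case: ifP => iu; last first.
  by rewrite lam_out ?iu // oppr0; apply: qcomm1l.
by case: rep => /(_ _ iu)[h1 h2] _; apply: (qcommVl q0 h1 h2); apply: qcomm_x.
Qed.

Lemma qcomm_yy u v : qcomm q (lam u v) (yi u) (yi v).
Proof.
case: (boolP (inner v)) => iv; last first.
  rewrite lam_out ?(negPf iv) ?andbF // {2}/yi (negPf iv).
  by rewrite -oppr0; apply/(qcomm_sym q0)/qcomm1l.
rewrite -[lam u v]opprK {2}/yi iv.
by case: rep => /(_ _ iv)[h1 h2] _; apply: (qcommVr q0 h1 h2); apply: qcomm_yx.
Qed.

Lemma qcomm_ew e f : edge G e.1 e.2 -> edge G f.1 f.2 ->
  qcomm q (qexp e f) (ew x xi e.1 e.2) (ew x xi f.1 f.2).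
Proof.
move=> he hf; rewrite /qexp.
have [He|/(edge_isV he) Ve] := boolP (isH e); last by rewrite (ew_V Ve); apply: qcomm1l.
have [Hf|/(edge_isV hf) Vf] := boolP (isH f); last first.
  by rewrite (ew_V Vf) -oppr0; apply/(qcomm_sym q0)/qcomm1l.
rewrite !ew_H ?edge_isH //=.
have ie := Hhead_inner SE (edge_isH he He); have i_f := Hhead_inner SE (edge_isH hf Hf).
have -> : bdiff lam e f = (lam e.1 f.1 + - lam e.1 f.2) + (- lam e.2 f.1 + lam e.2 f.2).
  by rewrite /bdiff; ring.
apply: (qcommMl q0); apply: (qcommMr q0).
- exact: qcomm_yy.
- exact: qcomm_yx.
- by rewrite -lam_anti -[lam _ _]opprK; apply: (qcomm_sym q0); apply: qcomm_yx.
exact: qcomm_x.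
Qed.

Lemma pw_prod s p : pw x xi s p = \prod_(e <- pedges s p) ew x xi e.1 e.2.
Proof.
elim: p s => [|v p IH] s /=; first by rewrite /Defs.pedges /= big_nil.
by rewrite IH /Defs.pedges /= big_cons.
Qed.
End Representation.

Lemma pedges_cons s v p : pedges s (v :: p) = (s, v) :: pedges v p.
Proof. by []. Qed.

Lemma pedges_rcons s p v : pedges s (rcons p v) = rcons (pedges s p) (last s p, v).
Proof. by elim: p s => [|w p IH] s //=; rewrite !pedges_cons IH. Qed.

Lemma pedges_edge s p e : path (edge G) s p -> e \in pedges s p -> edge G e.1 e.2.
Proof.
elim: p s => [|v p IH] s //= /andP[sv pp]; rewrite pedges_cons inE => /orP[/eqP->//|].
exact: IH.
Qed.

Lemma pedges_head s p e : e \in pedges s p -> e.2 \in p.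
Proof.
elim: p s => [|v p IH] s //=; rewrite pedges_cons !inE => /orP[/eqP->/=|/IH->].
  by rewrite eqxx.
by rewrite orbT.
Qed.

Lemma pedges_tail s p e : e \in pedges s p -> e.1 \in belast s p.
Proof.
elim: p s => [|v p IH] s //=; rewrite pedges_cons !inE => /orP[/eqP->/=|/IH->].
  by rewrite eqxx.
by rewrite orbT.
Qed.

Lemma belast_pedges s p v : v \in belast s p -> exists w, (v, w) \in pedges s p.
Proof.
elim: p s => [|z p IH] s //=; rewrite pedges_cons inE => /orP[/eqP->|/IH[w wp]].
  by exists z; rewrite inE eqxx.
by exists w; rewrite inE wp orbT.
Qed.

Lemma mem_pedges s p v : v \in p -> exists w, (w, v) \in pedges s p.
Proof.
elim: p s => [|z p IH] s //=; rewrite pedges_cons inE => /orP[/eqP->|/(IH z)[w wp]].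
  by exists s; rewrite inE eqxx.
by exists w; rewrite inE wp orbT.
Qed.

Lemma pedges_tele (g : V -> int) s p :
  \sum_(e <- pedges s p) (g e.2 - g e.1) = g (last s p) - g s.
Proof.
elim: p s => [|v p IH] s /=; first by rewrite /Defs.pedges /= big_nil subrr.
by rewrite pedges_cons big_cons IH /=; ring.
Qed.

Lemma sum_isH (F : V * V -> int) (r : seq (V * V)) c : \sum_(e <- r) F e = c ->
  \sum_(e <- r | isH e) F e = c - \sum_(e <- r | ~~ isH e) F e.
Proof. by move=> <-; rewrite [X in X - _](bigID isH) /= addrK. Qed.

Lemma lamV_outr u v : ~~ inner v -> lamV u v = 0.
Proof. by move=> /negPf h; rewrite /lamV /mdiff h andbF. Qed.

Lemma lamV_outl u v : ~~ inner u -> lamV u v = 0.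
Proof. by move=> /negPf h; rewrite /lamV /mdiff h. Qed.

Lemma src_out s : is_src s -> ~~ inner s. Proof. by rewrite /Defs.inner => ->. Qed.
Lemma snk_out s : is_snk s -> ~~ inner s. Proof. by rewrite /Defs.inner => ->; rewrite andbF. Qed.

(* Since the sources and sinks do not occur in [lamV], the sum of [bdiff lamV] over all the
   edges of a path vanishes, so its horizontal edges can be traded for its vertical ones,
   on which [lamV] is local. *)
Lemma qexp_paths s p t r :
  path (edge G) s p -> is_src s -> is_snk (last s p) ->
  path (edge G) t r -> is_src t -> is_snk (last t r) ->
  \sum_(e <- pedges s p) \sum_(f <- pedges t r) qexp e f =
  \sum_(e <- pedges s p) \sum_(f <- pedges t r) beta e f.
Proof.
move=> pp /src_out ss /snk_out sl pr /src_out ts /snk_out tl.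
have Dr e : \sum_(f <- pedges t r) bdiff lamV e f = 0.
  rewrite (pedges_tele (fun b => lamV e.2 b - lamV e.1 b)).
  by rewrite !lamV_outr // !subrr.
have Dl f : \sum_(e <- pedges s p) bdiff lamV e f = 0.
  under eq_bigr => e _.
    have -> : bdiff lamV e f = (lamV e.2 f.2 - lamV e.2 f.1) - (lamV e.1 f.2 - lamV e.1 f.1).
      by rewrite /bdiff; ring.
    over.
  rewrite (pedges_tele (fun a => lamV a f.2 - lamV a f.1)).
  by rewrite !lamV_outl // !subrr.
have DHV : \sum_(e <- pedges s p | isH e) \sum_(f <- pedges t r | isH f) bdiff lamV e f
    = \sum_(e <- pedges s p | ~~ isH e) \sum_(f <- pedges t r | ~~ isH f) bdiff lamV e f.
  under eq_bigr => e _ do rewrite (sum_isH (Dr e)) sub0r.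
  rewrite sumrN exchange_big /=.
  under eq_bigr => e _ do rewrite (sum_isH (Dl e)) sub0r.
  by rewrite sumrN opprK [LHS]exchange_big.
have -> : \sum_(e <- pedges s p) \sum_(f <- pedges t r) qexp e f =
   \sum_(e <- pedges s p | isH e) \sum_(f <- pedges t r | isH f) adj e f -
   \sum_(e <- pedges s p | isH e) \sum_(f <- pedges t r | isH f) bdiff lamV e f.
  rewrite -sumrB [RHS]big_mkcond /= !big_seq; apply: eq_bigr => e he.
  rewrite /qexp; case: ifP => He /=; last by rewrite big1.
  rewrite -sumrB [RHS]big_mkcond /= !big_seq; apply: eq_bigr => f hf.
  case: ifP => Hf //; rewrite bdiff_lam bdiff_lamH //.
    by apply: edge_isH He; apply: pedges_edge he.
  by apply: edge_isH Hf; apply: pedges_edge hf.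
rewrite DHV -sumrN [X in X + _]big_mkcond [X in _ + X]big_mkcond -big_split /= !big_seq.
apply: eq_bigr => e he; rewrite /beta; case: ifP => He /=.
  by rewrite addr0 big_mkcond.
rewrite add0r -sumrN big_mkcond /= !big_seq; apply: eq_bigr => f hf.
have [//|Hf] /= := boolP (isH f); rewrite bdiff_lamV //.
  by apply: edge_isV; [apply: pedges_edge he|rewrite He].
by apply: edge_isV Hf; apply: pedges_edge hf.
Qed.

Definition kappa e : int := (isH e && ~~ is_src e.1)%:Z.

(** When a horizontal edge [(u, v)] is appended, the vertical long-range terms telescope from the
    source to [u] and vanish, as [u] and [v] lie in one row. What remains is the unique earlier edge
    entering [u], absent when [u] is the source. So the ordered sum depends on the set of edges
    alone. *)
Lemma ordsum_path s p : path (edge G) s p -> is_src s ->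
  ordsum qexp (pedges s p) = \sum_(e <- pedges s p) kappa e.
Proof.
move=> + ss; elim/last_ind: p => [|p v IH]; first by rewrite /Defs.pedges /= big_nil.
rewrite pedges_rcons rcons_path => /andP[pp uv].
rewrite -cats1 ordsum_cat big_cat IH //=.
rewrite !big_seq1 !big_nil !addr0; congr (_ + _); set u := last s p in uv *.
under eq_bigr => e _ do rewrite big_seq1.
have [Hv|nHv] := boolP (isH (u, v)); last first.
  by rewrite big1 /kappa ?(negPf nHv) // => e _; rewrite /qexp (negPf nHv) andbF.
have Huv := edge_isH (e := (u, v)) uv Hv.
rewrite /kappa Hv /=; case/lastP E : p => [|p' w].
  by rewrite /u E /Defs.pedges /= big_nil ss.
have uw : u = w by rewrite /u E last_rcons.
have up : u \in p by rewrite uw E mem_rcons inE eqxx.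
have nsu : ~~ is_src u.
  move: pp; rewrite E rcons_path -uw => /andP[_ /(head_not_src SE)].
  by [].
have iu : inner u by rewrite /Defs.inner nsu (tail_not_snk SE uv).
have iv : inner v := Hhead_inner SE Huv.
have uq := path_uniq SE pp.
have vp : v \notin s :: p.
  have := path_uniq SE (s := s) (p := rcons p v); rewrite rcons_path pp uv => /(_ isT).
  by rewrite -rcons_cons rcons_uniq => /andP[].
have tl e : e \in pedges s p -> [/\ e.1 != u, e.1 != v & e.2 != v].
  move=> he; have h1 := pedges_tail he; have h2 := pedges_head he.
  have h3 := mem_belast h1.
  split; last by apply: contraNneq vp => <-; rewrite inE h2 orbT.
    move: uq; rewrite lastI rcons_uniq -/u => /andP[+ _].
    by apply: contraNneq => <-.
  by apply: contraNneq vp => <-.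
(* One formula for both kinds of [e]: on a horizontal edge it is the local value of [bdiff lamH], on
   a vertical one both sides are zero. *)
have step e : e \in pedges s p ->
  qexp e (u, v) = (e.2 == u)%:Z - bdiff lamV e (u, v).
  move=> he; have [t1 t2 t3] := tl _ he; have ee := pedges_edge pp he.
  rewrite /qexp Hv andbT; case: ifP => He.
    rewrite bdiff_lam bdiff_lamH //; last exact: edge_isH.
    by rewrite /adj /= (eq_sym v) (negPf t2) subr0.
  have Ve := edge_isV ee (negbT He).
  have i1 := Vtail_inner SE Ve.
  have i2 : inner e.2.
    have := pedges_head he => e2p; rewrite /Defs.inner (head_not_src SE ee) /=.
    apply/is_snkP => -[j ej]; have : e.2 \in s :: p by rewrite inE e2p orbT.
    rewrite lastI mem_rcons inE -/u => /orP[/eqP e2u|].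
      by move: uv; rewrite -e2u ej no_out_snk.
    by case/belast_pedges => z /(pedges_edge pp) /=; rewrite ej no_out_snk.
  rewrite /bdiff /lamV /mdiff /= i1 i2 iu iv /=.
  have := cdiff_step (Vfun SE) (Vinj SE) (Vacyc SE) v Ve.
  have := cdiff_step (Vfun SE) (Vinj SE) (Vacyc SE) u Ve.
  rewrite (eq_sym u) (negPf t1) (eq_sym u) (eq_sym v) (negPf t2) (eq_sym v) (negPf t3).
  rewrite addr0 add0r => <-; rewrite !(cdiff_anti _ u) !(cdiff_anti _ v) => Ev.
  by rewrite -[LHS]/(Posz false) -Ev; ring.
have tot : \sum_(e <- pedges s p) bdiff lamV e (u, v) = 0.
  under eq_bigr => e _.
    have -> : bdiff lamV e (u, v) = (lamV e.2 v - lamV e.2 u) - (lamV e.1 v - lamV e.1 u).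
      by rewrite /bdiff /=; ring.
    over.
  rewrite (pedges_tele (fun a => lamV a v - lamV a u)) -/u.
  rewrite ![lamV s _]lamV_outl ?src_out // /lamV /mdiff iu iv /= /cdiff.
  have -> : connect Vedge u v = false.
    by apply/negP => /(connectV_px SE); case/(HedgeP SE): Huv => _ /lt_eqF /eqP.
  have -> : connect Vedge v u = false.
    by apply/negP => /(connectV_px SE)/esym; case/(HedgeP SE): Huv => _ /lt_eqF /eqP.
  by rewrite !subrr.
have cnt : \sum_(e <- pedges s p) ((e.2 == u)%:Z : int) = 1.
  have -> : \sum_(e <- pedges s p) ((e.2 == u)%:Z : int) = \sum_(z <- p) (z == u)%:Z.
    elim: (p) (s) => [|z r IHr] t; first by rewrite /Defs.pedges /= !big_nil.
    by rewrite pedges_cons !big_cons IHr.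
  move: uq => /= /andP[_ uqp]; rewrite (bigD1_seq u) //= eqxx big1 ?addr0 // => z.
  by move/negPf->.
rewrite -E big_seq (eq_bigr _ step) sumrB -!big_seq cnt tot subr0.
by rewrite nsu.
Qed.
End Exponents.

(** * Flows *)

Section Flows.
Variables (R : realFieldType) (G : graph_data R).
Hypothesis SE : SEgraph G.
Local Notation V := (vert G).
Local Notation m := (nsrc G).
Local Notation n := (nsnk G).
Local Notation inner := (@inner R G).
Local Notation is_src := (@is_src R G).
Local Notation is_snk := (@is_snk R G).
Local Notation pedges := (@pedges R G).

Definition fword (P : 'I_m -> seq V) (r : seq 'I_m) : seq (V * V) :=
  flatten [seq pedges (src G i) (P i) | i <- r].

Lemma mem_fword P r e :
  reflect (exists2 i, i \in r & e \in pedges (src G i) (P i)) (e \in fword P r).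
Proof.
apply: (iffP flatten_mapP) => -[i]; by exists i.
Qed.

Lemma fword_cons P i r : fword P (i :: r) = pedges (src G i) (P i) ++ fword P r.
Proof. by []. Qed.

Lemma pedges_uniq s p : path (edge G) s p -> uniq (pedges s p).
Proof.
move=> /(path_uniq SE) /= /andP[_ up].
apply: (@map_uniq _ _ snd); rewrite (_ : map _ _ = p) //.
by elim: p s {up} => [|v p IH] s //; rewrite pedges_cons map_cons IH.
Qed.

Section OneFlow.
Variables (I : {set 'I_m}) (J : {set 'I_n}) (P : 'I_m -> seq V).
Hypothesis fl : is_flow I J P.

Lemma flow_path i : i \in I -> path (edge G) (src G i) (P i).
Proof. by case: fl => _ h _ _; apply: h. Qed.

Lemma flow_last i : i \in I -> exists2 j, j \in J & last (src G i) (P i) = snk G j.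
Proof.
case: fl => _ _ h _ iI.
have : last (src G i) (P i) \in [set snk G j | j in J] by rewrite -h; apply/imsetP; exists i.
by case/imsetP => j; exists j.
Qed.

Lemma flow_last_snk i : i \in I -> is_snk (last (src G i) (P i)).
Proof. by case/flow_last => j _ ->; apply: is_snk_snk. Qed.

Lemma flow_index v i i' : i \in I -> i' \in I ->
  v \in src G i :: P i -> v \in src G i' :: P i' -> i = i'.
Proof.
case: fl => _ _ _ h iI i'I vi vi'; apply/eqP; apply: contraT => ne.
by have := h _ _ iI i'I ne _ vi; rewrite vi'.
Qed.

Lemma pedges_ends s p (e : V * V) : e \in pedges s p -> e.1 \in s :: p /\ e.2 \in s :: p.
Proof.
move=> he; split; first by apply: mem_belast; apply: pedges_tail he.
by rewrite inE (pedges_head he) orbT.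
Qed.

Lemma flow_edgesP e :
  reflect (exists2 i, i \in I & e \in pedges (src G i) (P i)) (e \in flow_edges I P).
Proof.
rewrite inE; apply: (iffP existsP) => -[i]; first by case/andP; exists i.
by move=> h1 h2; exists i; rewrite h1.
Qed.

Lemma flow_edge e : e \in flow_edges I P -> edge G e.1 e.2.
Proof. by case/flow_edgesP => i /flow_path pp; apply: pedges_edge. Qed.

Lemma flow_in u u' v : (u, v) \in flow_edges I P -> (u', v) \in flow_edges I P -> u = u'.
Proof.
case/flow_edgesP => i iI h /flow_edgesP[i' i'I h'].
have E := flow_index iI i'I (pedges_ends h).2 (pedges_ends h').2.
rewrite -E in h'; have := path_uniq SE (flow_path iI) => /= /andP[_].
elim: (P i) (src G i) h h' => [|z p IH] s //; rewrite pedges_cons !inE /= => h h' /andP[zp up].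
case/orP: h => [/eqP[-> E1]|h]; case/orP: h' => [/eqP[-> E2]|h'] //.
- by move: (pedges_head h'); rewrite /= E1 (negPf zp).
- by move: (pedges_head h); rewrite /= E2 (negPf zp).
exact: IH h h' up.
Qed.

Lemma flow_out u v v' : (u, v) \in flow_edges I P -> (u, v') \in flow_edges I P -> v = v'.
Proof.
case/flow_edgesP => i iI h /flow_edgesP[i' i'I h'].
have E := flow_index iI i'I (pedges_ends h).1 (pedges_ends h').1.
rewrite -E in h'; have := path_uniq SE (flow_path iI).
elim: (P i) (src G i) h h' => [|z p IH] s //; rewrite pedges_cons !(in_cons (s,z)) => h h'.
rewrite [uniq _]/= -/(uniq (z :: p)) => /andP[sp up].
case/orP: h => [/eqP[E1 E2]|h]; case/orP: h' => [/eqP[E3 E4]|h'].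
- by rewrite E2 E4.
- by move: (pedges_ends h').1; rewrite /= E1 (negPf sp).
- by move: (pedges_ends h).1; rewrite /= E3 (negPf sp).
exact: IH h h' up.
Qed.

Lemma flow_in_out u v : inner v -> (u, v) \in flow_edges I P ->
  exists w, (v, w) \in flow_edges I P.
Proof.
move=> iv /flow_edgesP[i iI h].
have := (pedges_ends h).2; rewrite lastI mem_rcons inE => /orP[/eqP /= E|].
  by move: iv; rewrite E (negPf (snk_out (flow_last_snk iI))).
by case/belast_pedges => w hw; exists w; apply/flow_edgesP; exists i.
Qed.

Lemma flow_out_in v w : inner v -> (v, w) \in flow_edges I P ->
  exists u, (u, v) \in flow_edges I P.
Proof.
move=> iv /flow_edgesP[i iI h].
have := (pedges_ends h).1; rewrite inE => /orP[/eqP /= E|].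
  by move: iv; rewrite E (negPf (src_out (is_src_src i))).
by case/(mem_pedges (src G i)) => u hu; exists u; apply/flow_edgesP; exists i.
Qed.

Lemma flow_src i v : (src G i, v) \in flow_edges I P -> i \in I.
Proof.
case/flow_edgesP => i' iI h; have := (pedges_ends h).1; rewrite inE => /orP[/eqP /= E|].
  by rewrite (src_inj SE E).
case/(mem_pedges (src G i')) => u /(pedges_edge (flow_path iI)) /=.
by rewrite no_in_src.
Qed.

Lemma flow_snk j v : (v, snk G j) \in flow_edges I P -> j \in J.
Proof.
case/flow_edgesP => i iI h; have := (pedges_ends h).2; rewrite lastI mem_rcons inE.
case/orP => [/eqP /= E|]; last first.
  by case/belast_pedges => u /(pedges_edge (flow_path iI)) /=; rewrite no_out_snk.
by have [j' j'J E'] := flow_last iI; rewrite E' in E; rewrite (snk_inj SE E).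
Qed.

Lemma fword_uniq r : {subset r <= I} -> uniq r -> uniq (fword P r).
Proof.
elim: r => [|i r IH] sub // /andP[ir ur]; rewrite fword_cons cat_uniq.
have iI : i \in I by apply: sub; rewrite inE eqxx.
rewrite pedges_uniq ?flow_path //= IH // ?andbT; last first.
  by move=> k kr; apply: sub; rewrite inE kr orbT.
apply/hasPn => e /mem_fword[i' i'r he]; apply/negP => he'.
have E := flow_index iI (sub i' _) (pedges_ends he').1 (pedges_ends he).1.
by rewrite E ?i'r // inE i'r orbT in ir.
Qed.

(** Paths of a flow share no vertex, so [beta] vanishes between their edges. The exponents [qexp]
    between single edges need not vanish; only their total over two whole paths does. *)
Lemma ordsum_fword r : {subset r <= I} -> uniq r ->
  ordsum (@qexp R G) (fword P r) = \sum_(e <- fword P r) kappa e.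
Proof.
elim: r => [|i r IH] sub; first by rewrite /fword /= big_nil.
case/andP=> ir ur; rewrite fword_cons ordsum_cat big_cat /=.
have iI : i \in I by apply: sub; rewrite inE eqxx.
have sub' : {subset r <= I} by move=> k kr; apply: sub; rewrite inE kr orbT.
rewrite IH // (ordsum_path SE (flow_path iI) (is_src_src _)).
suff -> : \sum_(e <- pedges (src G i) (P i)) \sum_(f <- fword P r) qexp e f = 0.
  by rewrite addr0.
rewrite exchange_big /fword big_flatten big_map big_seq big1 //= => i' i'r.
rewrite exchange_big /=.
have i'I := sub' _ i'r.
rewrite qexp_paths ?flow_path ?is_src_src ?flow_last_snk //.
rewrite big_seq big1 //= => e he; rewrite big_seq big1 // => f hf.
suff E : adj e f = 0 by rewrite /beta E oppr0; do 2!case: ifP.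
have ne v : v \in src G i :: P i -> v \in src G i' :: P i' -> False.
  by move=> h1 h2; move: ir; rewrite (flow_index iI i'I h1 h2) i'r.
have [e1 e2] := pedges_ends he; have [f1 f2] := pedges_ends hf.
rewrite /adj; have [E|_] := eqVneq e.2 f.1; first by case: (ne f.1) => //; rewrite -E.
by have [E|_] := eqVneq f.2 e.1; first by case: (ne e.1) => //; rewrite -E.
Qed.

Definition fletters := fword P [seq i <- index_enum 'I_m | i \in I].

Lemma fsub : {subset [seq i <- index_enum 'I_m | i \in I] <= I}.
Proof. by move=> i; rewrite mem_filter => /andP[]. Qed.

Lemma fletters_uniq : uniq fletters.
Proof. by apply: fword_uniq fsub _; rewrite filter_uniq // index_enum_uniq. Qed.

Lemma mem_fletters : fletters =i flow_edges I P.
Proof.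
move=> e; apply/mem_fword/flow_edgesP => -[i iI he]; exists i => //.
  by apply: fsub.
by rewrite mem_filter iI mem_index_enum.
Qed.

Lemma big_fletters (F : V * V -> int) :
  \sum_(e <- fletters) F e = \sum_(e in flow_edges I P) F e.
Proof. by rewrite big_uniq ?fletters_uniq //; apply: eq_bigl => e; rewrite mem_fletters. Qed.

Lemma ordsum_fletters : ordsum (@qexp R G) fletters = \sum_(e <- fletters) kappa e.
Proof. by apply: ordsum_fword fsub _; rewrite filter_uniq // index_enum_uniq. Qed.

Lemma fw_fletters (K : fieldType) (A : algType K) (x xi : V -> A) :
  fw x xi I P = \prod_(e <- fletters) ew x xi e.1 e.2.
Proof.
rewrite /fw -[LHS]big_filter /fletters; elim: (filter _ _) => [|i r IH].
  by rewrite /fword !big_nil.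
by rewrite fword_cons big_cons big_cat /= IH pw_prod.
Qed.
End OneFlow.

Lemma qexp_flows (I I' : {set 'I_m}) (J J' : {set 'I_n}) P P' :
  is_flow I J P -> is_flow I' J' P' ->
  \sum_(e <- fletters I P) \sum_(f <- fletters I' P') qexp e f =
  \sum_(e in flow_edges I P) \sum_(f in flow_edges I' P') beta e f.
Proof.
move=> fl fl'; rewrite -(big_fletters fl) /fletters.
under [RHS]eq_bigr => e _ do rewrite -(big_fletters fl') /fletters.
rewrite /fword !big_flatten !big_map !big_seq; apply: eq_bigr => i /fsub iI.
under eq_bigr => e _ do rewrite big_flatten big_map big_seq.
under [RHS]eq_bigr => e _ do rewrite big_flatten big_map big_seq.
rewrite exchange_big [RHS]exchange_big /=; apply: eq_bigr => i' /fsub iI'.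
by apply: qexp_paths; rewrite ?is_src_src //;
  [apply: flow_path fl _ iI | apply: flow_last_snk fl _ iI
  | apply: flow_path fl' _ iI' | apply: flow_last_snk fl' _ iI'].
Qed.

Lemma flow_weights (K : fieldType) (q : K) (A : algType K) (x xi : V -> A)
    (I1 I2 I3 I4 : {set 'I_m}) (J1 J2 J3 J4 : {set 'I_n}) P1 P2 P3 P4 :
  q != 0 -> LG_rep q x xi ->
  is_flow I1 J1 P1 -> is_flow I2 J2 P2 -> is_flow I3 J3 P3 -> is_flow I4 J4 P4 ->
  (forall e, (e \in flow_edges I1 P1) + (e \in flow_edges I2 P2) =
             (e \in flow_edges I3 P3) + (e \in flow_edges I4 P4))%N ->
  exists2 N : int,
    N *+ 2 = \sum_(e in flow_edges I1 P1) \sum_(f in flow_edges I2 P2) beta e f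
           - \sum_(e in flow_edges I3 P3) \sum_(f in flow_edges I4 P4) beta e f &
    fw x xi I1 P1 * fw x xi I2 P2 = q ^ N *: (fw x xi I3 P3 * fw x xi I4 P4).
Proof.
move=> q0 rep f1 f2 f3 f4 cnt.
have pe : perm_eq (fletters I1 P1 ++ fletters I2 P2) (fletters I3 P3 ++ fletters I4 P4).
  apply/allP => e _ /=; rewrite !count_cat.
  rewrite !count_uniq_mem ?(fletters_uniq f1) ?(fletters_uniq f2) ?(fletters_uniq f3) ?(fletters_uniq f4) //.
  by rewrite !mem_fletters cnt.
have ed e : e \in fletters I1 P1 ++ fletters I2 P2 -> edge G e.1 e.2.
  by rewrite mem_cat !mem_fletters => /orP[]; apply: flow_edge; eassumption.
have [N N2 EN] := perm_prod_qcomm (W := fun e => ew x xi e.1 e.2) q0 (@qexp_anti R G)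
  (fun e f he hf => qcomm_ew SE q0 rep (ed _ he) (ed _ hf)) pe.
exists N; last by move: EN; rewrite !big_cat /= -!fw_fletters.
(* Self-interactions cancel, since [kappa] depends on single letters and the two words have the same
   letters; only the cross terms survive. *)
have kap : \sum_(e <- fletters I1 P1 ++ fletters I2 P2) kappa e =
    \sum_(e <- fletters I3 P3 ++ fletters I4 P4) kappa e by apply: perm_big.
rewrite N2 -(qexp_flows f1 f2) -(qexp_flows f3 f4) !ordsum_cat.
rewrite (ordsum_fletters f1) (ordsum_fletters f2) (ordsum_fletters f3) (ordsum_fletters f4).
move: kap; rewrite !big_cat /= => ->; ring.
Qed.
End Flows.

(** * Turns of the exchanged path *)

Section Sides.
Variables (R : realFieldType) (G : graph_data R).
Hypothesis SE : SEgraph G.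
Local Notation V := (vert G).
Local Notation px := (px G).
Local Notation py := (py G).
Local Notation Hedge := (@Hedge R G).
Local Notation Vedge := (@Vedge R G).
Local Notation klt := (@klt R G).
Implicit Types (e f g : V * V) (u v w : V).

Definition sgk u v : int := (klt u v)%:Z - (klt v u)%:Z.

Lemma sgk_anti u v : sgk v u = - sgk u v.
Proof. by rewrite /sgk opprB. Qed.

Lemma sgk_lt u v : klt u v -> sgk u v = 1.
Proof. by move=> h; rewrite /sgk h (klt_asym h). Qed.

Lemma sgk_gt u v : klt v u -> sgk u v = -1.
Proof. by move=> /sgk_lt h; rewrite sgk_anti h. Qed.

Definition overlap e f := klt e.1 f.2 && klt f.1 e.2.

(* [+1] if [f] passes above [e] on some sweep line meeting both, [-1] if below. *)
Definition side e f : int :=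
  if overlap e f then sgz ((py f.1 + py f.2) - (py e.1 + py e.2)) else 0.

Lemma side_anti e f : side f e = - side e f.
Proof.
by rewrite /side /overlap andbC; case: ifP; rewrite ?oppr0 // -sgzN opprB.
Qed.

Lemma klt_px u v : klt u v -> px u <= px v.
Proof. by case/kltP => [/ltW|[->]]. Qed.

Lemma incidentP e v : reflect (e.1 = v \/ e.2 = v) (incident e v).
Proof. by apply: (iffP orP) => -[/eqP|/eqP]; [left|right|left|right]. Qed.

(** The height of [v] decides for all of [e]: a horizontal [e] has constant height, and a vertical
    [e] cannot cross [g], so its other end is at most level with [g]. *)
Lemma side_point e g v : edge G e.1 e.2 -> incident e v -> Hedge g.1 g.2 ->
  klt g.1 v -> klt v g.2 -> side e g = sgz (py g.1 - py v).
Proof.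
move=> ee iev Hg gv vg; have ek := edge_klt SE ee.
have ov : overlap e g.
  rewrite /overlap; case/incidentP: iev => E; rewrite -E in gv vg.
    by rewrite vg (klt_trans gv ek).
  by rewrite gv (klt_trans ek vg).
rewrite /side ov; have [eg _] := HedgeP SE Hg; rewrite -eg.
have off := Hedge_off SE Hg gv vg.
have [p1 p2] := (klt_px gv, klt_px vg).
have [He|Ve] := edge_cases SE ee.
  have [ey _] := HedgeP SE He.
  have -> : py g.1 + py g.1 - (py e.1 + py e.2) = 2%:R * (py g.1 - py v).
    by case/incidentP: iev => <-; rewrite ey; ring.
  by rewrite sgzM gtr0_sgz ?ltr0n // mul1r.
have [ex ly] := VedgeP SE Ve.
case: (ltgtP (py v) (py g.1)) off => // h _.
  rewrite [RHS]gtr0_sgz ?subr_gt0 // gtr0_sgz //.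
  case/incidentP: iev => E; rewrite -E in h; first by lra.
  have [l|l] := leP (py e.1) (py g.1); first by lra.
  by case: (HV_no_cross SE Hg Ve _ _ h l); rewrite ?ex E.
rewrite [RHS]ltr0_sgz ?subr_lt0 // ltr0_sgz //.
case/incidentP: iev => E; rewrite -E in h; last by lra.
have [l|l] := leP (py g.1) (py e.2); first by lra.
by case: (HV_no_cross SE Hg Ve _ _ l h); rewrite E.
Qed.

Lemma strict_H g v : edge G g.1 g.2 -> klt g.1 v -> klt v g.2 -> Hedge g.1 g.2.
Proof. by move=> /(edge_cases SE)[//|Vg] h1 h2; case: (Vedge_gap SE Vg h1 h2). Qed.

Lemma sgk_cases g v : edge G g.1 g.2 -> sgk v g.2 != sgk v g.1 ->
  [\/ g.1 = v, g.2 = v | klt g.1 v /\ klt v g.2].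
Proof.
move=> /(edge_klt SE) gk.
have [->|n1] := eqVneq g.1 v; first by constructor.
have [->|n2] := eqVneq g.2 v; first by constructor.
move=> ne; constructor 3.
case/orP: (klt_total SE n1) => h1; case/orP: (klt_total SE n2) => h2 //.
- by rewrite !sgk_gt ?eqxx in ne.
- by move: gk; rewrite (klt_asym (klt_trans h2 h1)).
by rewrite !sgk_lt ?eqxx in ne.
Qed.

(** Just before [v] the vertical edge comes from above and the horizontal one from the left, so the
    vertical one is the upper. *)
Lemma side_in e f v : edge G e.1 e.2 -> edge G f.1 f.2 -> e.2 = v -> f.2 = v ->
  isH f = ~~ isH e -> side e f = (if isH e then 1 else -1).
Proof.
move=> ee ef e2 f2 hf; have [ek fk] := (edge_klt SE ee, edge_klt SE ef).
rewrite /side /overlap f2 -e2 ek e2 -f2 fk /= f2.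
case: ifP => He; rewrite He /= in hf.
  have [ey _] := HedgeP SE (edge_isH ee He).
  have [_ fy] := VedgeP SE (edge_isV SE ef (negbT hf)).
  by rewrite e2 in ey; rewrite gtr0_sgz // ey; rewrite f2 in fy; lra.
have [ey _] := HedgeP SE (edge_isH ef hf).
have [_ fy] := VedgeP SE (edge_isV SE ee (negbT He)).
by rewrite f2 in ey; rewrite ltr0_sgz // ey; rewrite e2 in fy; lra.
Qed.

(** Just after [v] the vertical edge hangs below the horizontal one. *)
Lemma side_out e f v : edge G e.1 e.2 -> edge G f.1 f.2 -> e.1 = v -> f.1 = v ->
  isH f = ~~ isH e -> side e f = (if isH e then -1 else 1).
Proof.
move=> ee ef e1 f1 hf; have [ek fk] := (edge_klt SE ee, edge_klt SE ef).
rewrite /side /overlap f1 -e1 ek e1 -f1 fk /= f1.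
case: ifP => He; rewrite He /= in hf.
  have [ey _] := HedgeP SE (edge_isH ee He).
  have [_ fy] := VedgeP SE (edge_isV SE ef (negbT hf)).
  by rewrite e1 in ey; rewrite ltr0_sgz // -ey; rewrite f1 in fy; lra.
have [ey _] := HedgeP SE (edge_isH ef hf).
have [_ fy] := VedgeP SE (edge_isV SE ee (negbT He)).
by rewrite f1 in ey; rewrite gtr0_sgz // -ey; rewrite e1 in fy; lra.
Qed.

Lemma side_overlap0l e g : g.2 = e.1 -> side e g = 0.
Proof. by move=> E; rewrite /side /overlap E klt_irr. Qed.

Lemma side_overlap0r e g : g.1 = e.2 -> side e g = 0.
Proof. by move=> E; rewrite /side /overlap E klt_irr andbF. Qed.

End Sides.

(** * Elementary evaluations of the sums over a leg of the triangle *)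

Lemma sum_last_step (s g : nat -> int) c n : (0 < n)%N ->
  (forall j, (0 < j <= n)%N -> g j = c) ->
  \sum_(1 <= j < n.+1) s j * (g j.+1 - g j) = s n * (g n.+1 - c).
Proof.
case: n => // n _ h; rewrite big_nat_recr //= big_nat_cond big1 => [|j].
  by rewrite add0r (h n.+1) //= leqnn.
by rewrite andbT => /andP[j1 jn]; rewrite (h j.+1) // (h j) ?j1 ?(ltnW jn) // subrr mulr0.
Qed.

Lemma sum_first_step (s g : nat -> int) c n : (0 < n)%N ->
  (forall j, (0 < j <= n)%N -> g j = c) ->
  \sum_(0 <= i < n) s i * (g i.+1 - g i) = s 0%N * (c - g 0%N).
Proof.
case: n => // n _ h; rewrite big_nat_recl // big_nat_cond big1 => [|j].
  by rewrite addr0 (h 1%N).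
by rewrite andbT => /andP[_ jn]; rewrite (h j.+2) // (h j.+1) ?subrr ?mulr0 //= ltnS ltnW.
Qed.

Lemma sum_const_side (s g : nat -> int) c m n : (m <= n)%N ->
  (forall j, (m <= j < n)%N -> g j.+1 != g j -> s j = c) ->
  \sum_(m <= j < n) s j * (g j.+1 - g j) = c * (g n - g m).
Proof.
move=> mn h; rewrite -telescope_sumr // mulr_sumr; apply: eq_big_nat => j jmn.
by have [->|/(h _ jmn)->] := eqVneq (g j.+1) (g j); rewrite ?subrr ?mulr0.
Qed.

(** * Local structure of two flows at a common vertex of their symmetric difference *)

Section Turns.
Variables (R : realFieldType) (G : graph_data R).
Hypothesis SE : SEgraph G.
Local Notation V := (vert G).
Local Notation inner := (@inner R G).
Implicit Types (e f g : V * V) (u v w : V) (b : bool).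

(* The two flows, as edge sets indexed by [true] and [false]. *)
Variable Fl : bool -> {set V * V}.
Hypothesis Fe : forall b e, e \in Fl b -> edge G e.1 e.2.
Hypothesis Fin : forall b u u' v, (u, v) \in Fl b -> (u', v) \in Fl b -> u = u'.
Hypothesis Fout : forall b u v v', (u, v) \in Fl b -> (u, v') \in Fl b -> v = v'.
Hypothesis Fio : forall b u v, inner v -> (u, v) \in Fl b -> exists w, (v, w) \in Fl b.
Hypothesis Foi : forall b v w, inner v -> (v, w) \in Fl b -> exists u, (u, v) \in Fl b.

Definition symU := symd (Fl true) (Fl false).

Lemma symUP e : reflect (exists b, e \in Fl b /\ e \notin Fl (~~ b)) (e \in symU).
Proof.
rewrite !inE; apply: (iffP orP).
  by case=> /andP[h1 h2]; [exists true|exists false].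
by case=> -[] [h1 h2]; [left|right]; rewrite h1 h2.
Qed.

Lemma symU_edge e : e \in symU -> edge G e.1 e.2.
Proof. by case/symUP => b [/Fe]. Qed.

Lemma Fin_eq b e f : e \in Fl b -> f \in Fl b -> e.2 = f.2 -> e = f.
Proof. by case: e f => u v [u' v'] /= h h' E; rewrite -E in h' *; rewrite (Fin h h'). Qed.

Lemma Fout_eq b e f : e \in Fl b -> f \in Fl b -> e.1 = f.1 -> e = f.
Proof. by case: e f => u v [u' v'] /= h h' E; rewrite -E in h' *; rewrite (Fout h h'). Qed.

Definition split_adj v e f :=
  [&& e \in symU, f \in symU, e != f, incident e v, incident f v &
     (degU symU v != 4) || ((e.2 == v) && (f.2 == v)) || ((e.1 == v) && (f.1 == v))].

Lemma adjUP e f : reflect (exists v, split_adj v e f) (adjU symU e f).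
Proof.
apply: (iffP and4P) => [[h1 h2 h3 /existsP[v /and3P[h4 h5 h6]]]|[v /and5P[h1 h2 h3 h4 /andP[h5 h6]]]].
  by exists v; apply/and5P; split=> //; apply/andP.
by split=> //; apply/existsP; exists v; apply/and3P.
Qed.

Lemma split_adj_sym v e f : split_adj v e f -> split_adj v f e.
Proof.
case/and5P=> h1 h2 h3 h4 /andP[h5 h6]; apply/and5P; split=> //; first by rewrite eq_sym.
by rewrite h4 (andbC (f.2 == v)) (andbC (f.1 == v)).
Qed.

(** The flow [b] carries [e]. The first two cases are the reversals, where the path passes from one
    flow to the other; they occur at degree 4 and also at degree 2, when the flows join or part at
    [v]. In the last two cases the path follows one flow, forwards or backwards. *)
Inductive turn v e f : Prop :=
| TurnIn b of e.2 = v & f.2 = v & e \in Fl b & e \notin Fl (~~ b) &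
    f \in Fl (~~ b) & f \notin Fl b & isH f = ~~ isH e
| TurnOut b of e.1 = v & f.1 = v & e \in Fl b & e \notin Fl (~~ b) &
    f \in Fl (~~ b) & f \notin Fl b & isH f = ~~ isH e
| TurnThru b of e.2 = v & f.1 = v & e \in Fl b & f \in Fl b &
    (forall g, g \in Fl (~~ b) -> ~~ incident g v)
| TurnBack b of e.1 = v & f.2 = v & e \in Fl b & f \in Fl b &
    (forall g, g \in Fl (~~ b) -> ~~ incident g v).

Lemma edge_neq e : edge G e.1 e.2 -> e.1 <> e.2.
Proof. by move=> /(edge_klt SE)/klt_neq/eqP. Qed.

(** If the other flow also met [v], the two flows would enter by different edges because [e] is not
    shared, and leave by different edges because [f] is not shared; the degree would then be 4. *)
Lemma thru_excl v e f : e \in symU -> f \in symU -> e.2 = v -> f.1 = v ->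
  degU symU v != 4 ->
  exists2 b, [/\ e \in Fl b, f \in Fl b & e \notin Fl (~~ b)] &
    forall g, g \in Fl (~~ b) -> ~~ incident g v.
Proof.
move=> /[dup] eU /symUP[b [eb enb]] fU e2 f1 d4.
have ee := Fe eb; have fe := symU_edge fU.
have iv : inner v.
  by rewrite /Defs.inner -{1}e2 (head_not_src SE ee) -f1 (tail_not_snk SE fe).
have noin u : (u, v) \notin Fl (~~ b).
  apply/negP => gb; move: d4; apply/negP; rewrite negbK.
  have [w wb] := Fio iv gb.
  have [w' wb'] : exists w', (v, w') \in Fl b by apply: (Fio iv (u := e.1)); rewrite -e2 -surjective_pairing.
  have ww' : w != w'.
    apply: contraTneq fU => E; apply/negP => /symUP[c [fc fnc]].
    rewrite -E in wb'; have [cb|cb] := eqVneq c b.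
      by rewrite cb in fc fnc; move: fnc; rewrite (Fout_eq fc wb' f1) wb.
    have cE : c = ~~ b by move: cb; case: (c); case: (b).
    by rewrite cE negbK in fc fnc; move: fnc; rewrite (Fout_eq fc wb f1) wb'.
  have gnb : (u, v) \notin Fl b.
    by apply: contra enb => h; rewrite (Fin_eq eb h e2).
  have wnb : (v, w) \notin Fl b by apply: contraNN ww' => h; rewrite (Fout h wb').
  have wnb' : (v, w') \notin Fl (~~ b) by apply: contraNN ww' => h; rewrite (Fout h wb).
  pose s := [:: e; (u, v); (v, w'); (v, w)].
  have us : uniq s.
    have nv z z' : (z', v) \in Fl (~~ b) \/ (z', v) \in Fl b -> (z', v) != (v, z).
      move=> h; apply/eqP => -[E _]; case: h => /Fe; rewrite /= E => /(edge_klt SE);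
      by rewrite klt_irr.
    have e_eq : e = (e.1, v) by rewrite -e2 -surjective_pairing.
    rewrite /= !inE !negb_or andbT -!andbA; apply/and5P; split.
    - by apply: contraNneq enb => ->.
    - by rewrite e_eq; apply: nv; right; rewrite -e_eq.
    - by rewrite e_eq; apply: nv; right; rewrite -e_eq.
    - by apply: nv; left.
    apply/andP; split; first by apply: nv; left.
    by apply: contraNneq ww' => -[->].
  have -> : degU symU v = #|s|.
    rewrite /degU; apply: eq_card => g; rewrite in_set /s ![in RHS]inE.
    apply/andP/idP => [[/symUP[c [gc gnc]] /incidentP gv]|].
      have [cb|cb] : c = b \/ c = ~~ b by case: (c); case: (b); [left|right|right|left].
        rewrite cb in gc; case: gv => gv.
          by rewrite -[(v, w')](Fout_eq gc wb' gv) eqxx !orbT.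
        by rewrite (Fin_eq gc eb) ?eqxx // gv.
      rewrite cb in gc; case: gv => gv.
        by rewrite -[(v, w)](Fout_eq gc wb gv) eqxx !orbT.
      by rewrite -[(u, v)](Fin_eq gc gb gv) eqxx !orbT.
    case/or4P => /eqP ->; split; rewrite /incident /= ?e2 ?eqxx ?orbT //; apply/symUP.
    - by exists (~~ b); rewrite negbK.
    - by exists b.
    - by exists (~~ b); rewrite negbK.
  by rewrite (card_uniqP us).
have none g : g \in Fl (~~ b) -> ~~ incident g v.
  move=> gb; apply/incidentP => -[gv|gv].
    have [u ub] : exists u, (u, v) \in Fl (~~ b).
      by apply: (Foi iv (w := g.2)); rewrite -gv -surjective_pairing.
    by move: (noin u); rewrite ub.
  by move: (noin g.1); rewrite -gv -surjective_pairing gb.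
exists b => //; split=> //.
case/symUP: fU => c [fc _]; have [<- //|cb] := eqVneq c b.
have cE : c = ~~ b by move: cb; case: (c); case: (b).
by rewrite cE in fc; move: (none _ fc); rewrite /incident f1 eqxx.
Qed.

Lemma split_adj_turn v e f : split_adj v e f -> inner v /\ turn v e f.
Proof.
case/and5P => eU fU ef /incidentP ev /andP[/incidentP fv cond].
have [ee fe] := (symU_edge eU, symU_edge fU).
case: (symUP _ eU) => b [eb enb]; case: (symUP _ fU) => c [fc fnc].
have ne := edge_neq ee; have nf := edge_neq fe.
have isH2 : (Hedge e.1 e.2 -> Hedge f.1 f.2 -> False) ->
    (Vedge e.1 e.2 -> Vedge f.1 f.2 -> False) -> isH f = ~~ isH e.
  move=> hH hV; case He: (isH e); case Hf: (isH f) => //=.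
    by case: (hH (edge_isH ee He) (edge_isH fe Hf)).
  by case: (hV (edge_isV SE ee (negbT He)) (edge_isV SE fe (negbT Hf))).
case: ev fv => [e1|e2] [f1|f2].
- have cE : c = ~~ b.
    have [cb|] := eqVneq c b; last by case: (c); case: (b).
    by rewrite cb in fc; rewrite (Fout_eq eb fc) ?eqxx ?e1 in ef.
  rewrite cE ?negbK in fc fnc.
  have hH : Hedge e.1 e.2 -> Hedge f.1 f.2 -> False.
    rewrite e1 f1 => h1 h2; move/eqP: ef; apply.
    by rewrite (surjective_pairing e) (surjective_pairing f) e1 f1 (Hfun SE h1 h2).
  have hV : Vedge e.1 e.2 -> Vedge f.1 f.2 -> False.
    rewrite e1 f1 => h1 h2; move/eqP: ef; apply.
    by rewrite (surjective_pairing e) (surjective_pairing f) e1 f1 (Vfun SE h1 h2).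
  split; last by apply: (TurnOut e1 f1 eb enb fc fnc); apply: isH2.
  (* At a source both edges would be horizontal with the same tail, hence equal. *)
  rewrite /Defs.inner -{2}e1 (tail_not_snk SE ee) andbT; apply/is_srcP => -[i E].
  by apply: hH; [rewrite e1 E; apply: src_edge; rewrite // -E -e1
    | rewrite f1 E; apply: src_edge; rewrite // -E -f1].
- have d4 : degU symU v != 4.
    case/orP: cond => [/orP[//|/andP[/eqP E _]]|/andP[_ /eqP E]].
      by case: ne; rewrite e1 E.
    by case: nf; rewrite f2 E.
  have [b' [h1 h2 h3] h4] := thru_excl fU eU f2 e1 d4.
  split; last exact: TurnBack e1 f2 h2 h1 h4.
  by rewrite /Defs.inner -{1}f2 (head_not_src SE fe) -e1 (tail_not_snk SE ee).
- have d4 : degU symU v != 4.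
    case/orP: cond => [/orP[//|/andP[_ /eqP E]]|/andP[/eqP E _]].
      by case: nf; rewrite f1 E.
    by case: ne; rewrite e2 E.
  have [b' [h1 h2 h3] h4] := thru_excl eU fU e2 f1 d4.
  split; last exact: TurnThru e2 f1 h1 h2 h4.
  by rewrite /Defs.inner -{1}e2 (head_not_src SE ee) -f1 (tail_not_snk SE fe).
have cE : c = ~~ b.
  have [cb|] := eqVneq c b; last by case: (c); case: (b).
  by rewrite cb in fc; rewrite (Fin_eq eb fc) ?eqxx ?e2 in ef.
rewrite cE ?negbK in fc fnc.
have hH : Hedge e.1 e.2 -> Hedge f.1 f.2 -> False.
  rewrite e2 f2 => h1 h2; move/eqP: ef; apply.
  by rewrite (surjective_pairing e) (surjective_pairing f) e2 f2 (Hinj SE h1 h2).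
have hV : Vedge e.1 e.2 -> Vedge f.1 f.2 -> False.
  rewrite e2 f2 => h1 h2; move/eqP: ef; apply.
  by rewrite (surjective_pairing e) (surjective_pairing f) e2 f2 (Vinj SE h1 h2).
split; last by apply: (TurnIn e2 f2 eb enb fc fnc); apply: isH2.
rewrite /Defs.inner -{1}e2 (head_not_src SE ee) /=; apply/is_snkP => -[j E].
by apply: hV; [rewrite e2 E; apply: snk_edge; rewrite // -E -e2
  | rewrite f2 E; apply: snk_edge; rewrite // -E -f2].
Qed.

(** Either the neighbour is the edge of the other flow at the same kind of end, or it is the next
    edge of the same flow and the other flow misses [v]. The alternatives exclude each other, and
    each determines the neighbour. *)
Lemma split_adj_uniq v e f f' : split_adj v e f -> split_adj v e f' -> f = f'.
Proof.
move=> h h'.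
have eU : e \in symU by case/and5P: h.
have ne := edge_neq (symU_edge eU).
have [_ t] := split_adj_turn h; have [_ t'] := split_adj_turn h'.
have bE b c : e \notin Fl (~~ b) -> e \in Fl c -> c = b.
  by case: b; case: c => //= /negPf ->.
have inc g (w : V) : g.1 = w \/ g.2 = w -> incident g w by move/incidentP.
case: t => b; case: t' => c.
- move=> E1 E2 x1 x2 x3 x4 _ E3 E4 y1 y2 y3 y4 _.
  by rewrite (bE _ _ y2 x1) in x3; apply: Fin_eq y3 x3 _; rewrite E4 E2.
- by move=> E1 E2 *; case: ne; rewrite E1; symmetry.
- move=> E1 E2 x1 x2 x3 E3 E4 y1 y2 y3 y4 _.
  by rewrite (bE _ _ y2 x1) in x3; move: (x3 _ y3); rewrite inc //; right.
- by move=> E1 E2 *; case: ne; rewrite E1; symmetry.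
- by move=> E1 E2 x1 x2 x3 x4 _ E3 *; case: ne; rewrite E1 E3.
- move=> E1 E2 x1 x2 x3 x4 _ E3 E4 y1 y2 y3 y4 _.
  by rewrite (bE _ _ y2 x1) in x3; apply: Fout_eq y3 x3 _; rewrite E4 E2.
- by move=> E1 E2 x1 x2 x3 E3 *; case: ne; rewrite E1 E3.
- move=> E1 E2 x1 x2 x3 E3 E4 y1 y2 y3 y4 _.
  by rewrite (bE _ _ y2 x1) in x3; move: (x3 _ y3); rewrite inc //; left.
- move=> E1 E2 x1 x2 x3 x4 _ E3 E4 y1 y2 y3.
  by rewrite -(bE _ _ x2 y1) in x3; move: (y3 _ x3); rewrite inc //; right.
- by move=> E1 E2 x1 x2 x3 x4 _ E3 *; case: ne; rewrite E1 E3.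
- move=> E1 E2 x1 x2 x3 E3 E4 y1 y2 y3.
  have [cb|cb] := eqVneq c b; first by rewrite cb in x2; apply: Fout_eq y2 x2 _; rewrite E4 E2.
  have cE : b = ~~ c by move: cb; case: (c); case: (b).
  by move: (x3 e); rewrite -cE => /(_ y1); rewrite inc //; right.
- by move=> E1 E2 x1 x2 x3 E3 *; case: ne; rewrite E1 E3.
- by move=> E1 E2 x1 x2 x3 x4 _ E3 *; case: ne; rewrite E1 E3.
- move=> E1 E2 x1 x2 x3 x4 _ E3 E4 y1 y2 y3.
  by rewrite -(bE _ _ x2 y1) in x3; move: (y3 _ x3); rewrite inc //; left.
- by move=> E1 E2 x1 x2 x3 E3 *; case: ne; rewrite E1 E3.
move=> E1 E2 x1 x2 x3 E3 E4 y1 y2 y3.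
have [cb|cb] := eqVneq c b; first by rewrite cb in x2; apply: Fin_eq y2 x2 _; rewrite E4 E2.
have cE : b = ~~ c by move: cb; case: (c); case: (b).
by move: (x3 e); rewrite -cE => /(_ y1); rewrite inc //; left.
Qed.

(** This is the absence of crossings, in the form that [turning_sum] requires. If [g] passes
    strictly over or under [v], its side is read off at [v] for both edges. If [g] ends at [v], it
    would be [e] or [f] or contradict a straight passage, except at a split vertex, where it
    overlaps neither edge and both sides are 0. *)
Lemma side_turn v e f g : split_adj v e f -> g \in symU -> g != e -> g != f ->
  sgk v g.2 != sgk v g.1 -> side e g = side f g.
Proof.
move=> h gU ge gf ne.
have gE := symU_edge gU.
have [ee fe ev fv] : [/\ edge G e.1 e.2, edge G f.1 f.2, incident e v & incident f v].
  by case/and5P: h => /symU_edge ? /symU_edge ? _ ? /andP[].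
have [_ t] := split_adj_turn h.
case/symUP: gU => a [ga gna].
have aE b : a = b \/ a = ~~ b by case: (a); case: (b); [left|right|right|left].
case: (sgk_cases SE gE ne) => [g1|g2|[l1 l2]]; last first.
- have Hg := strict_H SE gE l1 l2.
  by rewrite (side_point SE ee ev Hg l1 l2) (side_point SE fe fv Hg l1 l2).
- case: t => b.
  + move=> E1 E2 x1 x2 x3 x4 _; case: (aE b) => aE'; rewrite aE' in ga.
      by rewrite (Fin_eq ga x1) ?eqxx ?g2 // in ge.
    by rewrite (Fin_eq ga x3) ?eqxx ?g2 // in gf.
  + by move=> E1 E2 *; rewrite !side_overlap0l // g2.
  + move=> E1 E2 x1 x2 x3; case: (aE b) => aE'; rewrite aE' in ga.
      by rewrite (Fin_eq ga x1) ?eqxx ?g2 // in ge.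
    by move: (x3 _ ga); rewrite /incident g2 eqxx orbT.
  move=> E1 E2 x1 x2 x3; case: (aE b) => aE'; rewrite aE' in ga.
    by rewrite (Fin_eq ga x2) ?eqxx ?g2 // in gf.
  by move: (x3 _ ga); rewrite /incident g2 eqxx orbT.
case: t => b.
+ by move=> E1 E2 *; rewrite !side_overlap0r // g1.
+ move=> E1 E2 x1 x2 x3 x4 _; case: (aE b) => aE'; rewrite aE' in ga.
    by rewrite (Fout_eq ga x1) ?eqxx ?g1 // in ge.
  by rewrite (Fout_eq ga x3) ?eqxx ?g1 // in gf.
+ move=> E1 E2 x1 x2 x3; case: (aE b) => aE'; rewrite aE' in ga.
    by rewrite (Fout_eq ga x2) ?eqxx ?g1 // in gf.
  by move: (x3 _ ga); rewrite /incident g1 eqxx.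
move=> E1 E2 x1 x2 x3; case: (aE b) => aE'; rewrite aE' in ga.
  by rewrite (Fout_eq ga x1) ?eqxx ?g1 // in ge.
by move: (x3 _ ga); rewrite /incident g1 eqxx.
Qed.

Definition fsign e : int := (e \in Fl true)%:Z - (e \in Fl false)%:Z.
Definition hsign e : int := if isH e then 1 else -1.
Definition outc b v (h : bool) : int := \sum_(g in Fl b) ((g.1 == v) && (isH g == h))%:Z.
Definition inc b v (h : bool) : int := \sum_(g in Fl b) ((g.2 == v) && (isH g == h))%:Z.
Definition yout v h := outc true v h + outc false v h.
Definition yin v h := inc true v h + inc false v h.
Definition bsum e : int :=
  \sum_(g in Fl true) beta e g + \sum_(g in Fl false) beta e g.

Lemma beta_sum b e :
  \sum_(g in Fl b) beta e g = hsign e * (outc b e.2 (isH e) - inc b e.1 (isH e)).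
Proof.
rewrite /outc /inc -sumrB mulr_sumr; apply: eq_bigr => g _.
rewrite /beta /adj /hsign eq_sym.
by case: (isH e); case: (isH g); rewrite ?andbT ?andbF ?subrr ?mulr0 ?mul1r ?mulN1r.
Qed.

Lemma bsumE e : bsum e = hsign e * (yout e.2 (isH e) - yin e.1 (isH e)).
Proof. by rewrite /bsum !beta_sum /yout /yin; ring. Qed.

Lemma outc_some b e h : e \in Fl b -> outc b e.1 h = (isH e == h)%:Z.
Proof.
move=> eb; rewrite /outc (bigD1 e) //= eqxx big1 ?addr0 // => g /andP[gb ge].
by case: eqVneq => //= E; move: ge; rewrite (Fout_eq gb eb E) eqxx.
Qed.

Lemma inc_some b e h : e \in Fl b -> inc b e.2 h = (isH e == h)%:Z.
Proof.
move=> eb; rewrite /inc (bigD1 e) //= eqxx big1 ?addr0 // => g /andP[gb ge].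
by case: eqVneq => //= E; move: ge; rewrite (Fin_eq gb eb E) eqxx.
Qed.

Lemma outc_none b v h : (forall g, g \in Fl b -> g.1 != v) -> outc b v h = 0.
Proof. by move=> hv; rewrite /outc big1 // => g /hv /negPf ->. Qed.

Lemma inc_none b v h : (forall g, g \in Fl b -> g.2 != v) -> inc b v h = 0.
Proof. by move=> hv; rewrite /inc big1 // => g /hv /negPf ->. Qed.

Lemma youtE b v h : yout v h = outc b v h + outc (~~ b) v h.
Proof. by case: b; rewrite /yout // addrC. Qed.

Lemma yinE b v h : yin v h = inc b v h + inc (~~ b) v h.
Proof. by case: b; rewrite /yin // addrC. Qed.

Lemma outc_total b u v : inner v -> (u, v) \in Fl b -> outc b v true + outc b v false = 1.
Proof.
move=> iv /(Fio iv)[w wb]; have h := outc_some _ wb.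
by rewrite !h; case: (isH _).
Qed.

Lemma inc_total b v w : inner v -> (v, w) \in Fl b -> inc b v true + inc b v false = 1.
Proof.
move=> iv /(Foi iv)[u ub]; have h := inc_some _ ub.
by rewrite !h; case: (isH _).
Qed.

Definition bsign b : int := if b then 1 else -1.

Lemma fsignE b e : e \in Fl b -> e \notin Fl (~~ b) -> fsign e = bsign b.
Proof. by case: b => /= h /negPf h'; rewrite /fsign h h'. Qed.

(** The share of the end [v] in [bsum e]: a head sees the edges leaving it, a tail those entering
    it, in both flows and of the kind of [e]. *)
Definition cend e v : int :=
  if e.2 == v then hsign e * yout v (isH e) else - (hsign e * yin v (isH e)).
Definition dend e v : int := if e.2 == v then 1 else -1.

Lemma bsum_cend e : edge G e.1 e.2 -> bsum e = cend e e.1 + cend e e.2.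
Proof.
move=> /edge_neq/eqP ne; rewrite bsumE /cend eqxx eq_sym (negPf ne); ring.
Qed.

Lemma cend_tv e t : edge G e.1 e.2 -> incident e (tv t) -> cend e (tv t) = 0.
Proof.
move=> ee; rewrite /cend; case: t => i /= /incidentP et.
  have [E|_] := eqVneq e.2; first by move: ee; rewrite E no_in_src.
  rewrite /yin !inc_none ?addr0 ?mulr0 ?oppr0 // => g /Fe ge; apply/eqP => E;
  by rewrite E no_in_src in ge.
case: et => E; first by move: ee; rewrite E no_out_snk.
rewrite E eqxx /yout !outc_none ?addr0 ?mulr0 // => g /Fe ge; apply/eqP => E';
by rewrite E' no_out_snk in ge.
Qed.

(** On a straight passage the two shares cancel, and so do the end signs. At a reversal both edges
    have [v] as head, or both as tail, so the end signs add up to 2 in absolute value. The second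
    identity says that the path keeps following one flow forwards and the other backwards. *)
Lemma turn_term v e f : split_adj v e f ->
  fsign e * cend e v + fsign f * cend f v =
    fsign e * dend e v * side e f * (dend e v + dend f v) /\
  fsign f * dend f v = - (fsign e * dend e v).
Proof.
move=> h; have [iv t] := split_adj_turn h.
have [ee fe] : edge G e.1 e.2 /\ edge G f.1 f.2.
  by case/and5P: h => /symU_edge ? /symU_edge.
have [ne nf] := (edge_neq ee, edge_neq fe).
rewrite /cend /dend /hsign; case: t => b.
- move=> E1 E2 x1 x2 x3 x4 hf.
  have -> := fsignE x1 x2; have -> : fsign f = bsign (~~ b) by apply: fsignE; rewrite ?negbK.
  rewrite E1 E2 eqxx (side_in SE ee fe E1 E2 hf) hf.
  have t1 : outc b v true + outc b v false = 1.
    by apply: (outc_total (u := e.1) iv); rewrite -E1 -surjective_pairing.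
  have t2 : outc (~~ b) v true + outc (~~ b) v false = 1.
    by apply: (outc_total (u := f.1) iv); rewrite -E2 -surjective_pairing.
  (* Each flow leaves [v] exactly once, so the counts of the two kinds add up to 2, whichever kinds
     are taken. *)
  have tt : yout v true + yout v false = 1 + 1.
    by rewrite !(youtE b) -{1}t1 -t2; ring.
  have -> : bsign (~~ b) = - bsign b by case: (b).
  split; last by ring.
  by case: (isH e) => /=; rewrite -[X in _ = _ * X]tt; ring.
- move=> E1 E2 x1 x2 x3 x4 hf.
  have -> := fsignE x1 x2; have -> : fsign f = bsign (~~ b) by apply: fsignE; rewrite ?negbK.
  have ne2 : e.2 == v = false by apply/eqP => E; case: ne; rewrite E1.
  have nf2 : f.2 == v = false by apply/eqP => E; case: nf; rewrite E2.
  rewrite ne2 nf2 (side_out SE ee fe E1 E2 hf) hf.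
  have t1 : inc b v true + inc b v false = 1.
    by apply: (inc_total (w := e.2) iv); rewrite -E1 -surjective_pairing.
  have t2 : inc (~~ b) v true + inc (~~ b) v false = 1.
    by apply: (inc_total (w := f.2) iv); rewrite -E2 -surjective_pairing.
  have tt : - 1 + - 1 = - (yin v true + yin v false).
    by rewrite !(yinE b) -{1}t1 -t2; ring.
  have -> : bsign (~~ b) = - bsign b by case: (b).
  split; last by ring.
  by case: (isH e) => /=; rewrite [X in _ = _ * X]tt; ring.
- move=> E1 E2 x1 x2 x3.
  have ni g : g \in Fl (~~ b) -> g.1 != v /\ g.2 != v.
    by move=> /x3; rewrite /incident negb_or => /andP.
  have x1' : e \notin Fl (~~ b) by apply/negP => /ni[_]; rewrite E1 eqxx.
  have x2' : f \notin Fl (~~ b) by apply/negP => /ni[]; rewrite E2 eqxx.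
  have nf2 : f.2 == v = false by apply/eqP => E; case: nf; rewrite E2.
  rewrite (fsignE x1 x1') (fsignE x2 x2') E1 nf2 eqxx.
  have y1 : yout v (isH e) = (isH f == isH e)%:Z.
    have z h' : outc (~~ b) v h' = 0 by apply: outc_none => g /ni[].
    by rewrite (youtE b) z addr0 -E2 outc_some.
  have y2 : yin v (isH f) = (isH e == isH f)%:Z.
    have z h' : inc (~~ b) v h' = 0 by apply: inc_none => g /ni[].
    by rewrite (yinE b) z addr0 -E1 inc_some.
  rewrite y1 y2; split; last by ring.
  by case: (isH e); case: (isH f) => /=; ring.
move=> E1 E2 x1 x2 x3.
have ni g : g \in Fl (~~ b) -> g.1 != v /\ g.2 != v.
  by move=> /x3; rewrite /incident negb_or => /andP.
have x1' : e \notin Fl (~~ b) by apply/negP => /ni[]; rewrite E1 eqxx.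
have x2' : f \notin Fl (~~ b) by apply/negP => /ni[_]; rewrite E2 eqxx.
have ne2 : e.2 == v = false by apply/eqP => E; case: ne; rewrite E1.
rewrite (fsignE x1 x1') (fsignE x2 x2') E2 ne2 eqxx.
have y1 : yout v (isH f) = (isH e == isH f)%:Z.
  have z h' : outc (~~ b) v h' = 0 by apply: outc_none => g /ni[].
    by rewrite (youtE b) z addr0 -E1 outc_some.
have y2 : yin v (isH e) = (isH f == isH e)%:Z.
  have z h' : inc (~~ b) v h' = 0 by apply: inc_none => g /ni[].
    by rewrite (yinE b) z addr0 -E2 inc_some.
rewrite y1 y2; split; last by ring.
by case: (isH e); case: (isH f) => /=; ring.
Qed.

Definition other e v := if e.1 == v then e.2 else e.1.

Lemma other_cases e v : edge G e.1 e.2 -> incident e v ->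
  (e.1 = v /\ e.2 = other e v) \/ (e.2 = v /\ e.1 = other e v).
Proof.
move=> /edge_neq/eqP ne; rewrite /other => /incidentP[E|E]; first by left; rewrite E eqxx.
by right; rewrite -E (negPf ne).
Qed.

Lemma incident_cases e v w : edge G e.1 e.2 -> incident e v -> incident e w ->
  w = v \/ w = other e v.
Proof.
move=> ee /(other_cases ee)[[E1 E2]|[E1 E2]] /incidentP[<-|<-];
first [by left | by right].
Qed.

Lemma dend_other e v : edge G e.1 e.2 -> incident e v ->
  dend e (other e v) = sgk v (other e v) /\ dend e v = - sgk v (other e v).
Proof.
move=> ee iv; have ek := edge_klt SE ee.
have ne : e.2 == e.1 = false by rewrite eq_sym; apply/negbTE/klt_neq.
case: (other_cases ee iv) => [[E1 E2]|[E1 E2]]; rewrite -E2 -E1 /dend eqxx ne.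
  by rewrite (sgk_lt ek).
by rewrite (sgk_gt ek) opprK.
Qed.

(** * The exchanged path as a planar arc between two terminals *)

Section Chain.
Variables (A0 B0 : V) (ea : V * V) (p : seq (V * V)).
Hypotheses (nA : ~~ inner A0) (nB : ~~ inner B0) (AB : A0 != B0).
Hypotheses (eaU : ea \in symU) (iA : incident ea A0).
Hypotheses (chain : path (adjU symU) ea p) (uch : uniq (ea :: p)).
Hypothesis (iB : incident (last ea p) B0).

Local Notation es := (ea :: p).
Local Notation k := (size p).+1.
Let E i := nth ea es i.

Fixpoint pt i : V := if i is j.+1 then other (E j) (pt j) else A0.

Lemma chain_adj i : (i.+1 < k)%N -> adjU symU (E i) (E i.+1).
Proof. by move=> ik; apply: (pathP ea chain). Qed.

Lemma chain_U i : (i < k)%N -> E i \in symU.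
Proof.
case: i => [|i] ik; first by [].
by case/and4P: (chain_adj ik).
Qed.

Lemma chain_edge i : (i < k)%N -> edge G (E i).1 (E i).2.
Proof. by move/chain_U/symU_edge. Qed.

Lemma chain_neq i j : (i < k)%N -> (j < k)%N -> i != j -> E i != E j.
Proof. by move=> ik jk; rewrite /E nth_uniq. Qed.

(** Consecutive edges could share [pt i] instead of [pt i.+1] only by turning back: impossible at
    the terminal [A0], which is not inner, and later excluded by uniqueness of the neighbour at
    [pt i] in a chain without repetitions. *)
Lemma chain_split i : (i < k)%N -> incident (E i) (pt i) /\
  ((i.+1 < k)%N -> split_adj (pt i.+1) (E i) (E i.+1)).
Proof.
have step j : (j.+1 < k)%N -> incident (E j) (pt j) ->
    (forall w, split_adj w (E j) (E j.+1) -> w != pt j) -> split_adj (pt j.+1) (E j) (E j.+1).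
  move=> jk ij hw; have /adjUP[w sw] := chain_adj jk.
  have iw : incident (E j) w by case/and5P: sw.
  have [wE|wE] := incident_cases (chain_edge (ltnW jk)) ij iw; last by rewrite wE in sw.
  by have := hw _ sw; rewrite wE eqxx.
elim: i => [|i IH] ik.
  split=> // i1; apply: step => // w /split_adj_turn[iw _].
  by apply/eqP => wE; move: nA; rewrite -[A0]/(pt 0) -wE iw.
have [inc_i /(_ ik) si] := IH (ltnW ik).
have inc_i1 : incident (E i.+1) (pt i.+1) by case/and5P: si => _ _ _ _ /andP[].
split=> // i2; apply: step => // w sw; apply/eqP => wE; rewrite wE in sw.
have := split_adj_uniq (split_adj_sym si) sw; apply/eqP.
by apply: chain_neq; rewrite ?(ltnW (ltnW i2)) // neq_ltn ltnW.
Qed.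

Lemma chain_inc i : (i < k)%N -> incident (E i) (pt i).
Proof. by case/chain_split. Qed.

Lemma chain_sadj i : (i.+1 < k)%N -> split_adj (pt i.+1) (E i) (E i.+1).
Proof. by move=> ik; case/(_ ik): (chain_split (ltnW ik)).2. Qed.

Lemma pt_inner i : (i.+1 < k)%N -> inner (pt i.+1).
Proof. by move/chain_sadj/split_adj_turn => []. Qed.

Lemma pt_last : pt k = B0.
Proof.
have kk : (size p < k)%N by [].
have iB' : incident (E (size p)) B0 by rewrite /E -last_nth.
have [BE|-> //] := incident_cases (chain_edge kk) (chain_inc kk) iB'.
case: {2}(size p) (erefl (size p)) => [|i] ei; rewrite ei in BE.
  by move: AB; rewrite BE eqxx.
by move: nB; rewrite BE pt_inner // ei.
Qed.

(** Neighbours are unique at inner points and absent at terminals, so no step leaves the chain. Thus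
    the component exchanged is the arc itself. *)
Lemma chain_component : [set e | connect (adjU symU) ea e] =i es.
Proof.
move=> e; rewrite inE; apply/idP/idP; last first.
  by move=> ep; apply: path_connect chain _ ep.
have clos f g : f \in es -> adjU symU f g -> g \in es.
  move=> /(nthP ea)[i ik <-] /adjUP[w sw]; rewrite -/(E i) in sw.
  have iw : incident (E i) w by case/and5P: sw.
  case: (incident_cases (chain_edge ik) (chain_inc ik) iw) => wE.
    case: i ik sw {iw} wE => [|i] ik sw wE.
      by case/split_adj_turn: sw => + _; rewrite wE (negPf nA).
    rewrite wE in sw; rewrite -(split_adj_uniq (split_adj_sym (chain_sadj ik)) sw).
    by rewrite mem_nth //= ltnW.
  have {}wE : w = pt i.+1 by [].
  have [i1|i1] := ltnP i.+1 k.
    by rewrite wE in sw; rewrite -(split_adj_uniq (chain_sadj i1) sw) mem_nth.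
  have ei : i.+1 = k by apply/eqP; rewrite eqn_leq i1 andbT.
  by case/split_adj_turn: sw => + _; rewrite wE ei pt_last (negPf nB).
have gen r f : f \in es -> path (adjU symU) f r -> last f r \in es.
  elim: r f => [|g r IH] f fe //= /andP[/(clos _ _ fe) ge rp].
  exact: IH ge rp.
by case/connectP => r rp ->; apply: gen rp; rewrite inE eqxx.
Qed.

Lemma dend_next i : (i < k)%N -> dend (E i) (pt i.+1) = sgk (pt i) (pt i.+1).
Proof. by move=> ik; case: (dend_other (chain_edge ik) (chain_inc ik)). Qed.

Lemma dend_prev i : (i < k)%N -> dend (E i) (pt i) = - sgk (pt i) (pt i.+1).
Proof. by move=> ik; case: (dend_other (chain_edge ik) (chain_inc ik)). Qed.

(** The orientation of the arc: 1 if it runs along edges of the first flow forwards and of the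
    second backwards, -1 in the opposite case. *)
Definition eps := fsign ea * sgk (pt 0) (pt 1).

Lemma eps_const i : (i < k)%N -> fsign (E i) * sgk (pt i) (pt i.+1) = eps.
Proof.
elim: i => [|i IH] ik //; rewrite -(IH (ltnW ik)).
have [_] := turn_term (chain_sadj ik).
rewrite dend_next ?(ltnW ik) // dend_prev // => /eqP.
by rewrite mulrN eqr_opp => /eqP.
Qed.

(** Each [bsum] is split between the two ends of its edge and regrouped by vertices; the terminals
    contribute nothing, and [turn_term] gives the rest. *)
Lemma chain_rotation :
  \sum_(e in [set e | connect (adjU symU) ea e]) fsign e * bsum e =
  - eps * \sum_(0 <= i < k.-1) side (E i) (E i.+1) *
     (sgk (pt i.+1) (pt i.+2) - sgk (pt i) (pt i.+1)).
Proof.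
have -> : \sum_(e in [set e | connect (adjU symU) ea e]) fsign e * bsum e
        = \sum_(e <- es) fsign e * bsum e.
  by rewrite big_uniq //; apply: eq_bigl => e; rewrite chain_component.
rewrite (big_nth ea).
pose X i := fsign (E i) * cend (E i) (pt i).
pose Y i := fsign (E i) * cend (E i) (pt i.+1).
have -> : \sum_(0 <= i < size es) fsign (nth ea es i) * bsum (nth ea es i)
        = \sum_(0 <= i < k) (X i + Y i).
  apply: eq_big_nat => i /andP[_ ik]; rewrite -/(E i) bsum_cend ?chain_edge // /X /Y -mulrDr.
  by case: (other_cases (chain_edge ik) (chain_inc ik)) => -[-> ->] //; rewrite addrC.
have -> : \sum_(0 <= i < k) (X i + Y i) = X 0%N + \sum_(0 <= i < k.-1) (Y i + X i.+1) + Y k.-1.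
  rewrite /=; elim: (size p) => [|j IH]; first by rewrite big_nat1 big_geq // addr0.
  by rewrite big_nat_recr //= IH [in RHS]big_nat_recr //=; ring.
have tvn v : ~~ inner v -> exists t, v = tv t.
  by move=> /not_inner[/is_srcP[i ->]|/is_snkP[i ->]]; [exists (inl i)|exists (inr i)].
have X0 : X 0%N = 0.
  have [t tE] := tvn _ nA; rewrite /X /= tE cend_tv ?mulr0 //.
    exact: (chain_edge (i := 0)).
  by rewrite -tE.
have Yk : Y k.-1 = 0.
  have [t tE] := tvn _ nB; rewrite /Y pt_last tE cend_tv ?mulr0 //.
    exact: chain_edge.
  by rewrite /E /= -(last_nth ea) -tE.
rewrite X0 Yk add0r addr0 mulr_sumr; apply: eq_big_nat => i /andP[_ ik].
have ik' : (i < k)%N by apply: ltnW.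
have [H _] := turn_term (chain_sadj ik).
rewrite /X /Y H dend_next // dend_prev // eps_const //; ring.
Qed.

Lemma chain_legs :
  \sum_(0 <= i < k.-1) side (E i) (E i.+1) *
     (sgk (pt i.+1) (pt i.+2) - sgk (pt i) (pt i.+1)) =
  \sum_(1 <= j < k) side (E 0) (E j) * (sgk (pt 0) (pt j.+1) - sgk (pt 0) (pt j))
  + \sum_(0 <= i < k.-1) side (E i) (E k.-1) * (sgk (pt i.+1) (pt k) - sgk (pt i) (pt k)).
Proof.
apply: (@turning_sum (fun i j => side (E i) (E j)) (fun i j => sgk (pt i) (pt j))).
- by move=> i j; apply: side_anti.
- by move=> i j; apply: sgk_anti.
move=> i j ik jk ji ji1 ne; apply: (side_turn (chain_sadj ik)).
- exact: chain_U.
- by apply: chain_neq => //; apply: ltnW.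
- exact: chain_neq.
by case: (other_cases (chain_edge jk) (chain_inc jk)) => -[-> ->] //; rewrite eq_sym.
Qed.

Lemma edge_inner u v : edge G u v -> inner u \/ inner v.
Proof. by case/(edge_cases SE) => [/(Hhead_inner SE)|/(Vtail_inner SE)]; [right|left]. Qed.

(** A single edge cannot join two terminals, as every edge has an inner end. *)
Lemma chain_size : (0 < size p)%N.
Proof.
case: p iB => [|//] iB'; have ee := symU_edge eaU.
have [E0|E0] := incident_cases ee iA iB'; first by move: AB; rewrite E0 eqxx.
have := edge_inner ee; case: (other_cases ee iA) => -[-> ->]; rewrite -E0;
by rewrite (negPf nA) (negPf nB) => -[].
Qed.

Lemma src_klt i v : ~~ is_src v -> klt (src G i) v.
Proof. by move=> /(src_px_lt SE i) h; apply/kltP; left. Qed.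

Lemma sgk_src_inner i v : inner v -> sgk (src G i) v = 1.
Proof. by case/andP => h _; apply: sgk_lt; apply: src_klt. Qed.

(** Only one edge enters a sink and none leaves it, so [g] passes strictly over the sink, which is a
    lowest vertex. *)
Lemma side_snk e g j : edge G e.1 e.2 -> edge G g.1 g.2 -> e.2 = snk G j -> g != e ->
  sgk (snk G j) g.2 != sgk (snk G j) g.1 -> side e g = 1.
Proof.
move=> ee ge e2 gne ne.
case: (sgk_cases SE ge ne) => [g1|g2|[l1 l2]].
- by move: ge; rewrite g1 no_out_snk.
- have Ve : Vedge e.1 (snk G j) by apply: snk_edge; rewrite // -e2.
  have Vg : Vedge g.1 (snk G j) by apply: snk_edge; rewrite // -g2.
  by move/eqP: gne; case; rewrite (surjective_pairing g) (surjective_pairing e) e2 g2 (Vinj SE Ve Vg).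
have iev : incident e (snk G j) by rewrite /incident e2 eqxx orbT.
rewrite (side_point SE ee iev (strict_H SE ge l1 l2) l1 l2) gtr0_sgz // subr_gt0.
exact: snk_py_lt (tail_not_snk SE ge).
Qed.

Lemma chain_ends_neq i v : (i < k)%N -> sgk v (pt i.+1) != sgk v (pt i) ->
  sgk v (E i).2 != sgk v (E i).1.
Proof.
move=> ik; case: (other_cases (chain_edge ik) (chain_inc ik)) => -[-> ->] //.
by rewrite eq_sym.
Qed.

Lemma chain_last : E (size p) = last ea p.
Proof. by rewrite /E -last_nth. Qed.

Lemma pt_inner_le j : (0 < j <= size p)%N -> inner (pt j).
Proof. by case: j => // j jk; apply: pt_inner. Qed.

(** From a source, which is leftmost, all inner points are seen forward; the sign can jump only at
    the last step. *)
Lemma leg0_src i : A0 = src G i ->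
  \sum_(1 <= j < k) side (E 0) (E j) * (sgk (pt 0) (pt j.+1) - sgk (pt 0) (pt j))
  = side ea (last ea p) * (sgk A0 B0 - 1).
Proof.
move=> Ai.
rewrite (@sum_last_step (fun j => side (E 0) (E j)) (fun j => sgk A0 (pt j)) 1) ?chain_size //.
  by rewrite chain_last pt_last.
by move=> j /pt_inner_le; rewrite Ai; apply: sgk_src_inner.
Qed.

Lemma legk_src i : B0 = src G i ->
  \sum_(0 <= i < k.-1) side (E i) (E k.-1) * (sgk (pt i.+1) (pt k) - sgk (pt i) (pt k))
  = side ea (last ea p) * (-1 - sgk A0 B0).
Proof.
move=> Bi; rewrite pt_last.
rewrite (@sum_first_step (fun j => side (E j) (E (size p))) (fun j => sgk (pt j) B0) (-1))
  ?chain_size //; first by rewrite chain_last.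
by move=> j /pt_inner_le ij; rewrite sgk_anti Bi sgk_src_inner.
Qed.

(** Every edge across which the sign jumps passes above the edge into the sink, so the side is
    constantly 1 and the sum telescopes. *)
Lemma leg0_snk i : A0 = snk G i ->
  \sum_(1 <= j < k) side (E 0) (E j) * (sgk (pt 0) (pt j.+1) - sgk (pt 0) (pt j))
  = sgk A0 B0 - sgk A0 (pt 1).
Proof.
move=> Ai; have ee := symU_edge eaU.
rewrite (@sum_const_side (fun j => side (E 0) (E j)) (fun j => sgk A0 (pt j)) 1) //.
  by rewrite pt_last mul1r.
move=> j /andP[j1 jk] ne; apply: (@side_snk _ _ i ee (chain_edge jk)).
- by move/incidentP: iA; rewrite Ai => -[E0|//]; move: ee; rewrite E0 no_out_snk.
- by rewrite -[ea]/(E 0); apply: chain_neq => //; rewrite -lt0n.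
by rewrite -Ai; apply: chain_ends_neq.
Qed.

Lemma legk_snk i : B0 = snk G i ->
  \sum_(0 <= i < k.-1) side (E i) (E k.-1) * (sgk (pt i.+1) (pt k) - sgk (pt i) (pt k))
  = sgk A0 B0 - sgk (pt (size p)) B0.
Proof.
move=> Bi; rewrite pt_last; have kk : (size p < k)%N by [].
rewrite (@sum_const_side (fun j => side (E j) (E (size p))) (fun j => sgk (pt j) B0) (-1)) //.
  by rewrite mulN1r opprB.
move=> j /andP[_ jk] ne; rewrite side_anti; congr (- _).
apply: (@side_snk _ _ i (chain_edge kk) (chain_edge (ltnW jk))).
- move/incidentP: iB; rewrite -chain_last Bi => -[E0|//].
  by move: (chain_edge kk); rewrite E0 no_out_snk.
- by apply: chain_neq => //; [apply: ltnW | rewrite neq_ltn jk].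
rewrite -Bi; apply: chain_ends_neq; first exact: ltnW.
by rewrite (sgk_anti (pt j.+1)) (sgk_anti (pt j)) eqr_opp.
Qed.

Lemma sgk_first_src i : A0 = src G i -> sgk A0 (pt 1) = 1.
Proof.
move=> Ai; rewrite Ai sgk_src_inner //; apply: pt_inner_le; exact: chain_size.
Qed.

Lemma sgk_first_snk i : A0 = snk G i -> sgk A0 (pt 1) = -1.
Proof.
move=> Ai; have ee := symU_edge eaU; apply: sgk_gt.
case: (other_cases ee iA) => -[E1 E2].
  by move: ee; rewrite E1 Ai no_out_snk.
by rewrite -[pt 1]/(other ea A0) -E2 -[X in klt _ X]E1; apply: edge_klt.
Qed.

Lemma sgk_last_snk i : B0 = snk G i -> sgk (pt (size p)) B0 = 1.
Proof.
move=> Bi; have kk : (size p < k)%N by []; have ee := chain_edge kk.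
have BE : B0 = other (E (size p)) (pt (size p)) by rewrite -pt_last.
apply: sgk_lt; case: (other_cases ee (chain_inc kk)) => -[E1 E2].
  by rewrite BE -E2 -{1}E1; apply: edge_klt.
by move: ee; rewrite E2 -BE Bi no_out_snk.
Qed.

Local Notation total :=
  (\sum_(e in [set e | connect (adjU symU) ea e]) fsign e * bsum e).

Lemma total_src_src i j : A0 = src G i -> B0 = src G j -> (i < j)%N ->
  total = fsign ea *+ 2.
Proof.
move=> Af Bg fg; rewrite chain_rotation chain_legs (leg0_src Af) (legk_src Bg).
(* Both end edges are horizontal and leave sources, so they overlap and compare like these sources.
   The sign of the secant between the sources then cancels from the two legs. *)
have -> : side ea (last ea p) = 1.
  have ee := symU_edge eaU; have el : edge G (last ea p).1 (last ea p).2.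
    by rewrite -chain_last; apply: chain_edge.
  have e1 : ea.1 = A0.
    by move/incidentP: iA; rewrite Af => -[//|E2]; move: ee; rewrite E2 no_in_src.
  have l1 : (last ea p).1 = B0.
    by move/incidentP: iB; rewrite Bg => -[//|E2]; move: el; rewrite E2 no_in_src.
  have He : Hedge ea.1 ea.2 by rewrite e1 Af; apply: src_edge; rewrite // -Af -e1.
  have Hl : Hedge (last ea p).1 (last ea p).2.
    by rewrite l1 Bg; apply: src_edge; rewrite // -Bg -l1.
  rewrite /side /overlap {1}e1 Af l1 Bg !src_klt ?(head_not_src SE ee) ?(head_not_src SE el) //=.
  have [ey _] := HedgeP SE He; have [ly _] := HedgeP SE Hl.
  rewrite -ey -ly e1 l1 Af Bg gtr0_sgz //.
  by case: SE => _ [_ [_ [_ [_ [/(_ _ _ fg) + _]]]]]; lra.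
by rewrite /eps /= -/(pt 1) (sgk_first_src Af) mulr2n; ring.
Qed.

Lemma total_snk_snk i j : A0 = snk G i -> B0 = snk G j -> (i < j)%N ->
  total = fsign ea *+ 2.
Proof.
move=> Af Bg fg; rewrite chain_rotation chain_legs (leg0_snk Af) (legk_snk Bg).
rewrite (sgk_last_snk Bg) /eps [sgk (pt 0) (pt 1)](sgk_first_snk Af).
rewrite (sgk_lt (u := A0) (v := B0)); first by rewrite mulr2n; ring.
apply/kltP; left; rewrite Af Bg.
by case: SE => _ [_ [_ [_ [_ [_ [_ [/(_ _ _ fg)]]]]]]].
Qed.

Lemma total_src_snk i j : A0 = src G i -> B0 = snk G j -> total = 0.
Proof.
move=> Af Bg; rewrite chain_rotation chain_legs (leg0_src Af) (legk_snk Bg) (sgk_last_snk Bg).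
rewrite (sgk_lt (u := A0) (v := B0)); first by ring.
by rewrite Af Bg; apply: src_klt; rewrite snk_not_src.
Qed.

Lemma total_snk_src i j : A0 = snk G i -> B0 = src G j -> total = 0.
Proof.
move=> Af Bg; rewrite chain_rotation chain_legs (leg0_snk Af) (legk_src Bg) (sgk_first_snk Af).
rewrite (sgk_gt (u := A0) (v := B0)); first by ring.
by rewrite Af Bg; apply: src_klt; rewrite snk_not_src.
Qed.

End Chain.
End Turns.

(** * Effect of the exchange *)

Section Exchange.
Variables (T : finType) (beta : T -> T -> int).
Hypothesis beta_anti : forall x y, beta y x = - beta x y.

Let D (a b : T -> int) : int := \sum_x \sum_y a x * b y * beta x y.

Lemma pairing_anti a b : D b a = - D a b.
Proof.
rewrite /D exchange_big -sumrN; apply: eq_bigr => x _; rewrite -sumrN.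
by apply: eq_bigr => y _; rewrite beta_anti; ring.
Qed.

Lemma pairingDl a c b : D (fun x => a x + c x) b = D a b + D c b.
Proof.
rewrite /D -big_split; apply: eq_bigr => x _; rewrite -big_split.
by apply: eq_bigr => y _ /=; ring.
Qed.

Lemma pairingNl a b : D (fun x => - a x) b = - D a b.
Proof.
rewrite /D -sumrN; apply: eq_bigr => x _; rewrite -sumrN.
by apply: eq_bigr => y _; ring.
Qed.

Lemma pairingDr a b c : D a (fun x => b x + c x) = D a b + D a c.
Proof. by rewrite pairing_anti pairingDl opprD -!pairing_anti. Qed.

Lemma pairing_set (A B : {set T}) :
  \sum_(x in A) \sum_(y in B) beta x y = D (fun x => (x \in A)%:Z) (fun x => (x \in B)%:Z).
Proof.
rewrite /D big_mkcond; apply: eq_bigr => x _; case: ifP => xA; last first.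
  by rewrite big1 // => y _; rewrite !mul0r.
by rewrite big_mkcond; apply: eq_bigr => y _; case: ifP => yB; rewrite ?mulr0 ?mul0r ?mul1r.
Qed.

Lemma exchange_pairing (F F' X : {set T}) : X \subset symd F F' ->
  \sum_(x in F) \sum_(y in F') beta x y
  - \sum_(x in symd F X) \sum_(y in symd F' X) beta x y
  = \sum_(x in X) ((x \in F)%:Z - (x \in F')%:Z)
      * (\sum_(y in F) beta x y + \sum_(y in F') beta x y).
Proof.
move=> /subsetP sub; rewrite !pairing_set.
pose a x : int := (x \in F)%:Z; pose b x : int := (x \in F')%:Z.
pose d x : int := if x \in X then a x - b x else 0.
(* On [X] exactly one of [a] and [b] is 1, so toggling membership amounts to subtracting [d] from
   [a] and adding it to [b]. *)
have eF : (fun x => (x \in symd F X)%:Z) =1 (fun x => a x + - d x).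
  move=> x; rewrite /d /a /b; have := sub x; rewrite !inE.
  by case: (x \in X) => [/(_ isT)|_]; case: (x \in F); case: (x \in F').
have eF' : (fun x => (x \in symd F' X)%:Z) =1 (fun x => b x + d x).
  move=> x; rewrite /d /a /b; have := sub x; rewrite !inE.
  by case: (x \in X) => [/(_ isT)|_]; case: (x \in F); case: (x \in F').
have -> : D (fun x => (x \in symd F X)%:Z) (fun x => (x \in symd F' X)%:Z)
    = D (fun x => a x + - d x) (fun x => b x + d x).
  by apply: eq_bigr => x _; apply: eq_bigr => y _; rewrite eF eF'.
rewrite pairingDl pairingNl !pairingDr.
have dd : D d d = 0 by have := pairing_anti d d; lia.
have ad := pairing_anti a d; have -> : \sum_(x in X) (a x - b x) *
    (\sum_(y in F) beta x y + \sum_(y in F') beta x y) = D d a + D d b.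
  rewrite /D -big_split big_mkcond; apply: eq_bigr => x _ /=; rewrite /d.
  case: ifP => xX; last by rewrite !big1 ?addr0 // => y _; rewrite !mul0r.
  rewrite mulrDr !mulr_sumr; congr (_ + _); rewrite big_mkcond; apply: eq_bigr => y _;
  by rewrite /a /b; case: (y \in _); rewrite ?mulr1 ?mulr0 ?mul0r.
rewrite ad dd /a /b; ring.
Qed.
End Exchange.

Lemma mulr2n_inj (m n : int) : m *+ 2 = n *+ 2 -> m = n.
Proof. lia. Qed.

Theorem theorem4p4 (K : fieldType) (q : K) (R : realFieldType) (G : graph_data R)
    (I I' : {set 'I_(nsrc G)}) (J J' : {set 'I_(nsnk G)})
    (P P' : 'I_(nsrc G) -> seq (vert G))
    (a b : 'I_(nsrc G) + 'I_(nsnk G)) (ea eb : vert G * vert G)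
    (Q Q' : 'I_(nsrc G) -> seq (vert G)) :
  q != 0 -> SEgraph G ->
  is_flow I J P -> is_flow I' J' P' ->
  let U := symd (flow_edges I P) (flow_edges I' P') in
  (* pi = {a, b} is a couple of M(phi, phi') *)
  a != b -> a \in terminals I I' J J' -> b \in terminals I I' J J' ->
  ea \in U -> incident ea (tv a) -> eb \in U -> incident eb (tv b) ->
  connect (adjU U) ea eb ->
  (* E_{P(pi)} : the edges of the split path joining a and b *)
  let EP := [set e | connect (adjU U) ea e] in
  (* (psi, psi') obtained by the flow exchange using pi *)
  is_flow (symd I (couple_r a b)) (symd J (couple_c a b)) Q ->
  is_flow (symd I' (couple_r a b)) (symd J' (couple_c a b)) Q' ->
  flow_edges (symd I (couple_r a b)) Q = symd (flow_edges I P) EP ->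
  flow_edges (symd I' (couple_r a b)) Q' = symd (flow_edges I' P') EP ->
  (* equalities in L_G, i.e. in every K-algebra representation of L_G *)
  forall (A : algType K) (x xi : vert G -> A), LG_rep q x xi ->
  let lhs := fw x xi I P * fw x xi I' P' in
  let rhs := fw x xi (symd I (couple_r a b)) Q * fw x xi (symd I' (couple_r a b)) Q' in
  [/\ (* (i) R-couple *)
      forall f g : 'I_(nsrc G), a = inl f -> b = inl g -> (f < g)%N ->
        (f \in I -> lhs = q *: rhs) /\ (f \in I' -> lhs = q^-1 *: rhs),
      (* (i) C-couple *)
      forall f g : 'I_(nsnk G), a = inr f -> b = inr g -> (f < g)%N ->
        (f \in J -> lhs = q *: rhs) /\ (f \in J' -> lhs = q^-1 *: rhs) &
      (* (ii) RC-couple *)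
      (exists f g, a = inl f /\ b = inr g) \/ (exists f g, a = inr f /\ b = inl g) ->
        lhs = rhs].
Proof.
move=> q0 SE fl fl' U ab aT _ eaU iA ebU iB con EP flQ flQ' EQ EQ' A x xi rep lhs rhs.
pose Fl (c : bool) := if c then flow_edges I P else flow_edges I' P'.
have Fe c e : e \in Fl c -> edge G e.1 e.2.
  by case: c; apply: flow_edge; [exact: fl|exact: fl'].
have Fin c u u' v : (u, v) \in Fl c -> (u', v) \in Fl c -> u = u'.
  by case: c; apply: flow_in SE _ _ _ _ _ _ _; eassumption.
have Fout c u v v' : (u, v) \in Fl c -> (u, v') \in Fl c -> v = v'.
  by case: c; apply: flow_out SE _ _ _ _ _ _ _; eassumption.
have Fio c u v : inner v -> (u, v) \in Fl c -> exists w, (v, w) \in Fl c.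
  by case: c; [apply: flow_in_out fl _ _ | apply: flow_in_out fl' _ _].
have Foi c v w : inner v -> (v, w) \in Fl c -> exists u, (u, v) \in Fl c.
  by case: c; apply: flow_out_in.
have nA : ~~ inner (tv a) by rewrite tv_not_inner.
have nB : ~~ inner (tv b) by rewrite tv_not_inner.
have AB : tv a != tv b by rewrite (inj_eq (tv_inj SE)).
(* The connecting walk is shortened so that positions along it name distinct edges. *)
have [p [chain ep uch]] : exists p, [/\ path (adjU (symU Fl)) ea p, last ea p = eb & uniq (ea :: p)].
  by case/connectP: con => p0 + ->; case/shortenP => p pp up _; exists p.
rewrite -ep in iB.
have EPU : EP \subset U.
  apply/subsetP => e.
  rewrite (chain_component SE Fe Fin Fout Fio Foi nA nB AB eaU iA chain uch iB).
  by case/(nthP ea) => i ik <-; apply: (chain_U eaU chain).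
have cnt e : ((e \in flow_edges I P) + (e \in flow_edges I' P') =
    (e \in flow_edges (symd I (couple_r a b)) Q)
    + (e \in flow_edges (symd I' (couple_r a b)) Q'))%N.
  rewrite EQ EQ'; have := subsetP EPU e; rewrite /U !in_setU !in_setD.
  by case: (e \in EP) => [/(_ isT)|_]; case: (e \in flow_edges I P); case: (e \in flow_edges I' P').
have [N N2 EN] := flow_weights SE q0 rep fl fl' flQ flQ' cnt.
rewrite EQ EQ' (exchange_pairing (@beta_anti R G)) // -/U in N2.
have sgn1 : ea \notin Fl false -> fsign Fl ea = 1.
  by move=> h; apply: (fsignE (b := true)) => //; case/(@symUP _ _ Fl): eaU => -[] [] //=; rewrite (negPf h).
have sgnN1 : ea \notin Fl true -> fsign Fl ea = -1.
  by move=> h; apply: (fsignE (b := false)) => //; case/(@symUP _ _ Fl): eaU => -[] [] //=; rewrite (negPf h).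
have ee : edge G ea.1 ea.2 by apply: (symU_edge Fe).
have conc (c : int) : N *+ 2 = c *+ 2 -> lhs = q ^ c *: rhs.
  by move=> E; rewrite /lhs EN; congr (q ^ _ *: _); apply: mulr2n_inj.
(* A flow uses an edge at a terminal only if that terminal is one of its own. As [a] belongs to
   exactly one of the two flows, this decides which of them contains [ea], hence the sign of the
   exponent. *)
have res f : incident ea (tv f) -> ea \in Fl true -> match f with
    inl i => i \in I | inr j => j \in J end.
  case: f => i /incidentP[] E h; move: (h) ee; rewrite (surjective_pairing ea) /= ?E.
  - by move=> /(flow_src SE fl).
  - by rewrite no_in_src.
  - by rewrite no_out_snk.
  by move=> /(flow_snk SE fl).
have res' f : incident ea (tv f) -> ea \in Fl false -> match f with
    inl i => i \in I' | inr j => j \in J' end.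
  case: f => i /incidentP[] E h; move: (h) ee; rewrite (surjective_pairing ea) /= ?E.
  - by move=> /(flow_src SE fl').
  - by rewrite no_in_src.
  - by rewrite no_out_snk.
  by move=> /(flow_snk SE fl').
have {}res : ea \in Fl true -> match a with inl i => i \in I | inr j => j \in J end.
  exact: res.
have {}res' : ea \in Fl false -> match a with inl i => i \in I' | inr j => j \in J' end.
  exact: res'.
have fin : N *+ 2 = fsign Fl ea *+ 2 ->
    (ea \notin Fl false -> lhs = q *: rhs) /\ (ea \notin Fl true -> lhs = q^-1 *: rhs).
  move=> E; split=> [/sgn1 h|/sgnN1 h]; rewrite (conc _ E) h; first by rewrite expr1z.
  by rewrite exprN1.
move: aT; rewrite inE => aT.
split=> [i j ai bj ij|i j ai bj ij|].
- have := total_src_src SE Fe Fin Fout Fio Foi nA nB AB eaU iA chain uch iB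
    (congr1 (@tv R G) ai) (congr1 (@tv R G) bj) ij.
  move=> /(etrans N2)/fin[h1 h2]; rewrite ai in aT res res'.
  by split=> iI; [apply: h1; apply: contraTN iI => /res' h | apply: h2; apply: contraTN iI => /res h];
    move: aT; rewrite in_setU !in_setD h ?andbF ?orbF //= => /andP[].
- have := total_snk_snk SE Fe Fin Fout Fio Foi nA nB AB eaU iA chain uch iB
    (congr1 (@tv R G) ai) (congr1 (@tv R G) bj) ij.
  move=> /(etrans N2)/fin[h1 h2]; rewrite ai in aT res res'.
  by split=> iI; [apply: h1; apply: contraTN iI => /res' h | apply: h2; apply: contraTN iI => /res h];
    move: aT; rewrite in_setU !in_setD h ?andbF ?orbF //= => /andP[].
case=> -[i [j [ai bj]]].
  have := total_src_snk SE Fe Fin Fout Fio Foi nA nB AB eaU iA chain uch iB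
    (congr1 (@tv R G) ai) (congr1 (@tv R G) bj).
  by move=> /(etrans N2) /(conc 0); rewrite expr0z scale1r.
have := total_snk_src SE Fe Fin Fout Fio Foi nA nB AB eaU iA chain uch iB
  (congr1 (@tv R G) ai) (congr1 (@tv R G) bj).
by move=> /(etrans N2) /(conc 0); rewrite expr0z scale1r.
Qed.
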